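(* Let $n\ge 7$ and $3\le k\le n-3$, and let $H$ be a strong $k$-tournament on $n$ vertices. Then: (i) $H$ is vertex-pancyclic; (ii) every Hamiltonian cycle $C$ of $H$ contains at least three pancyclic hyperarcs.
   Context: For $2\le k\le n$, a $k$-tournament $H$ on $n$ vertices is a pair $(V,A)$ where $V$ is a set of $n$ vertices and $A$ is a set of $k$-tuples of distinct vertices (hyperarcs) such that for every $k$-subset $S\subseteq V$, $A$ contains exactly one of the $k!$ orderings of $S$. For a hyperarc $a=(x_1\dots x_k)$, $x_i$ precedes $x_j$ in $a$ if $i<j$. A path of length $m$ is an alternating sequence $x_1a_1x_2\dots x_ma_mx_{m+1}$ of distinct vertices and distinct hyperarcs with $x_i$ preceding $x_{i+1}$ in $a_i$; it is a cycle of length $m$ if instead $x_{m+1}=x_1$ (other vertices distinct). A cycle is Hamiltonian if it contains all vertices. $H$ is strong if for every ordered pair $(u,v)$ of distinct vertices there is a path from $u$ to $v$. A vertex (resp. hyperarc) is pancyclic if it is contained in a cycle of length $l$ for every $l\in\{3,\dots,n\}$; $H$ is vertex-pancyclic if all its vertices are pancyclic. *)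

(* Defs.v *)
From mathcomp Require Import all_boot.
Set Implicit Arguments. Unset Strict Implicit. Unset Printing Implicit Defensive.

Section KTour.
Variables (V : finType) (k : nat).

Definition is_ktournament (A : {set k.-tuple V}) : Prop :=
  (forall t : k.-tuple V, t \in A -> uniq t) /\
  (forall S : {set V}, #|S| = k ->
     #|[set t in A | [set x in t] == S]| = 1).

Definition precedes (t : k.-tuple V) (x y : V) : bool :=
  [&& x \in t, y \in t & index x t < index y t].

Definition is_path (A : {set k.-tuple V}) (m : nat)
    (x : 'I_m.+1 -> V) (a : 'I_m -> k.-tuple V) : Prop :=
  injective x /\ injective a /\
  (forall i, a i \in A) /\
  (forall i : 'I_m, precedes (a i) (x (widen_ord (leqnSn m) i)) (x (lift ord0 i))).

Definition is_cycle (A : {set k.-tuple V}) (m : nat)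
    (x : 'I_m -> V) (a : 'I_m -> k.-tuple V) : Prop :=
  injective x /\ injective a /\
  (forall i, a i \in A) /\
  (forall i : 'I_m, precedes (a i) (x i) (x (ordS i))).

Definition strong (A : {set k.-tuple V}) : Prop :=
  forall u v : V, u != v ->
    exists m (x : 'I_m.+1 -> V) (a : 'I_m -> k.-tuple V),
      is_path A x a /\ x ord0 = u /\ x ord_max = v.

Definition pancyclic_vertex (A : {set k.-tuple V}) (v : V) : Prop :=
  forall l, 3 <= l <= #|V| ->
    exists (x : 'I_l -> V) (a : 'I_l -> k.-tuple V),
      is_cycle A x a /\ exists i, x i = v.

Definition pancyclic_arc (A : {set k.-tuple V}) (b : k.-tuple V) : Prop :=
  forall l, 3 <= l <= #|V| ->
    exists (x : 'I_l -> V) (a : 'I_l -> k.-tuple V),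
      is_cycle A x a /\ exists i, a i = b.

Definition vertex_pancyclic (A : {set k.-tuple V}) : Prop :=
  forall v : V, pancyclic_vertex A v.

End KTour.

(* Main.v *)
(* A Hamiltonian cycle C of H, together with its hyperarcs, extends by Hall's theorem to
   an injective choice of one hyperarc for every pair of vertices, since enough k-sets
   remain for the pairs that are not consecutive on C. The orientations given by the
   chosen hyperarcs form a tournament T whose cycles are cycles of H and for which C is
   Hamiltonian. Both claims then follow from theorems of Moon: strong tournaments are
   vertex-pancyclic, and each of their Hamiltonian cycles contains three pancyclic arcs.

   A Hamiltonian cycle of H exists because of the tournament M in which x -> y if most
   hyperarcs on x and y put x first. If M is not strong, a shortest path of H from its
   last to its first strong component is closed by a path of M through all remaining
   vertices. Again by Hall's theorem, the arcs of M get distinct unused hyperarcs; only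
   n = 7, k = 4 requires some rerouting. *)
Require Import Defs.
From mathcomp Require Import all_boot.
From mathcomp Require Import zify.
Set Implicit Arguments. Unset Strict Implicit. Unset Printing Implicit Defensive.

(** * Insertion in paths of a tournament *)

Section Tournament.
Variables (T : eqType) (e : rel T).

(** A single hyperarc can serve several pairs of vertices, while a cycle needs distinct ones; giving
    every arc a hyperarc of its own is what makes ordinary tournament theory applicable. The k-sets
    above a family of pairs are compared with the triples above it: a k-set has ['C(k, 3)] triples,
    a triple lies in ['C(n - 3, k - 3)] k-sets, and [k <= n - 3] makes the second number at least as
    large as the first.

    An arc of the majority tournament carries at least half of the ['C(n - 2, k - 2)] hyperarcs on
    its ends. For [k >= 4] and [n >= 8] this is at least [n], enough whatever is already used. For
    [k = 3] it is small, but a used triple can then interfere with few arcs. For [n = 7] and [k = 4]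
    it is five, while the path through [H] may use six. There the minimality of that path helps: no
    hyperarc puts its start before its end, so all ten hyperarcs on these two vertices go back from
    the end to the start. *)

Definition tournament :=
  (forall x, e x x = false) /\ (forall x y, x != y -> e x y = ~~ e y x).

(* [z -> w -> z'] for some [z] before [z'] in [s]; if [s] is a path of a tournament,
   then [w] also fits between two consecutive vertices of [s]. *)
Fixpoint insertable (w : T) (s : seq T) : bool :=
  if s is z :: s' then e z w && has (e w) s' || insertable w s' else false.

Lemma has_subseq (a : pred T) (s s' : seq T) : subseq s s' -> has a s -> has a s'.
Proof. by move=> /mem_subseq sub /hasP[x /sub xs ax]; apply/hasP; exists x. Qed.

Lemma insertable_subseq w s s' : subseq s s' -> insertable w s -> insertable w s'.
Proof.
elim: s' s => [|b s' IH] [|a s] //= sub.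
case: ifP sub => [/eqP <- sub|_ sub].
  case/orP=> [/andP[-> /(has_subseq sub) ->] //|/(IH _ sub) ->]; exact: orbT.
by move=> ins; rewrite (IH _ sub ins) orbT.
Qed.

Lemma insertable_cat w s1 z s2 z' :
  e z w -> z' \in s2 -> e w z' -> insertable w (s1 ++ z :: s2).
Proof.
move=> ezw z's ewz'; elim: s1 => [|a s1 IH] /=; last by rewrite IH orbT.
by rewrite ezw /=; apply/orP; left; apply/hasP; exists z'.
Qed.

Hypothesis tour : tournament.
Let irr x : e x x = false. Proof. by case: tour. Qed.
Let tot x y : x != y -> e x y = ~~ e y x. Proof. by case: tour => _; apply. Qed.

Lemma arc_neq x y : e x y -> x != y.
Proof. by apply: contraTneq => ->; rewrite irr. Qed.

Lemma arc_asym x y : e x y -> e y x = false.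
Proof. by move=> exy; rewrite tot 1?eq_sym ?arc_neq // exy. Qed.

Lemma narc x y : x != y -> ~~ e x y -> e y x.
Proof. by move=> xy /negPf nxy; rewrite tot 1?eq_sym // nxy. Qed.

(** Where [w] does not fit, its in-neighbours form a final segment of the sequence; the next two
    lemmas read this off at the two ends. *)
Lemma not_insertable_in w s1 z s2 z' : w \notin s1 ++ z :: s2 ->
  ~~ insertable w (s1 ++ z :: s2) -> e z w -> z' \in s2 -> e z' w.
Proof.
move=> ws ni ezw z's2; apply: contraR ni => nez'; apply: (insertable_cat _ ezw z's2).
apply: narc nez'; apply: contraNneq ws => <-.
by rewrite mem_cat inE z's2 !orbT.
Qed.

Lemma not_insertable_last w s x z : w \notin rcons s x ->
  ~~ insertable w (rcons s x) -> e z w -> z \in rcons s x -> e x w.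
Proof.
move=> ws ni ezw; rewrite mem_rcons inE => /orP[/eqP <- //|zs].
case/splitPr: zs ws ni => s1 s2; rewrite -cats1 -catA /= cats1 => ws ni.
by apply: (not_insertable_in ws ni ezw); rewrite mem_rcons mem_head.
Qed.

Lemma not_insertable_head w y s z : w \notin y :: s ->
  ~~ insertable w (y :: s) -> e w z -> z \in y :: s -> e w y.
Proof.
move=> ws ni ewz; rewrite inE => /orP[/eqP <- //|zs].
apply: contraR ni => nwy; have eyw: e y w.
  by apply: narc nwy; apply: contraNneq ws => ->; rewrite mem_head.
by rewrite /= eyw /=; apply/orP; left; apply/hasP; exists z.
Qed.

Lemma insert_path w a p : path e a p -> w \notin a :: p -> insertable w (a :: p) ->
  exists p', [/\ path e a p', last a p' = last a p, perm_eq p' (w :: p) & subseq p p'].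
Proof.
elim: p a => [|b p IH] a; first by rewrite /= andbF.
move=> /andP[eab pp]; rewrite inE negb_or => /andP[wa wp] ins.
have step q : path e b q -> last b q = last b p -> perm_eq q (w :: p) -> subseq p q ->
  exists p', [/\ path e a p', last a p' = last a (b :: p), perm_eq p' (w :: b :: p)
    & subseq (b :: p) p'].
  move=> pq lq eq sq; exists (b :: q); split=> //=; last by rewrite eqxx.
    by rewrite eab.
  by rewrite -(perm_cons b) in eq; apply: perm_trans eq _; apply/permPl/(perm_catCA [:: b] [:: w]).
(* If [w] does not dominate [b], then [b -> w], and [b] can replace [a] as the in-neighbour, because
   the out-neighbour of [w] comes after [b]. *)
have: e a w && e w b || insertable w (b :: p).
  move: ins => /=; case: (boolP (e w b)) => [_|nwb]; first by rewrite orTb.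
  rewrite (narc _ nwb); last by apply: contraNneq wp => ->; rewrite mem_head.
  by rewrite andbF /=; case: (e a w); case: (has _ _).
case/orP=> [/andP[eaw ewb]|{}ins].
  exists (w :: b :: p); split=> //; first by rewrite /= eaw ewb.
  exact: subseq_cons.
by have [q [? ? ? ?]] := IH b pp wp ins; apply: (step q).
Qed.

Lemma insert_seq W a p : path e a p -> uniq (W ++ a :: p) ->
    all (insertable^~ (a :: p)) W ->
  exists p', [/\ path e a p', last a p' = last a p & perm_eq p' (W ++ p)].
Proof.
move=> pp uW aW.
suff [p' [? ? ? _]]: exists p',
    [/\ path e a p', last a p' = last a p, perm_eq p' (W ++ p) & subseq p p'] by exists p'.
elim: W uW aW => [|w W IH] /=; first by exists p.
move=> /andP[wW uW] /andP[iw aW]; have [q [pq lq eq sq]] := IH uW aW.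
have wq: w \notin a :: q.
  move: wW; rewrite mem_cat !inE (perm_mem eq) mem_cat.
  by case: (w \in W); case: (w \in p); case: (w == a).
have iq: insertable w (a :: q) by apply: (insertable_subseq _ (iw : insertable w (a :: p))); rewrite /= eqxx.
have [q' [pq' lq' eq' sq']] := insert_path pq wq iq.
exists q'; split; rewrite ?lq' //; last exact: subseq_trans sq sq'.
by apply: perm_trans eq' _; rewrite perm_cons.
Qed.

(** The set [D] serves the induction for Moon's theorem: cycles of a shorter Hamiltonian cycle's
    vertex set must avoid the vertices that were cut off. *)
Definition in_cycle (D : {pred T}) (l : nat) (x y : T) : Prop :=
  exists p, [/\ cycle e (x :: y :: p), uniq (x :: y :: p), all [in D] (x :: y :: p)
    & size p + 2 = l].

Definition pan (D : {pred T}) (n : nat) (x y : T) : Prop :=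
  forall l, 3 <= l <= n -> in_cycle D l x y.

Lemma in_cycle_sub (D D' : {pred T}) l x y : {subset D <= D'} -> in_cycle D l x y -> in_cycle D' l x y.
Proof.
by move=> sub [p [cp up /allP ap sp]]; exists p; split=> //; apply/allP => z /ap /sub.
Qed.

Lemma in_cycle_path (D : {pred T}) x y p : path e y p -> last y p = x -> e x y ->
  uniq (y :: p) -> all [in D] (y :: p) -> in_cycle D (size p).+1 x y.
Proof.
case/lastP: p => [|p z]; first by move=> _ /= ->; rewrite irr.
rewrite last_rcons => pp zx exy up ap; subst z.
exists p; split.
- by rewrite /= exy.
- by move: up; rewrite -rcons_cons rcons_uniq.
- by move: ap; rewrite -rcons_cons all_rcons.
- by rewrite size_rcons addn2.
Qed.

Lemma in_cycle_mid (D : {pred T}) s1 x y s2 : cycle e (s1 ++ x :: y :: s2) ->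
  uniq (s1 ++ x :: y :: s2) -> all [in D] (s1 ++ x :: y :: s2) ->
  in_cycle D (size (s1 ++ x :: y :: s2)) x y.
Proof.
move=> cs us asl; exists (s2 ++ s1); rewrite -!cat_cons.
have E: rot (size s1) (s1 ++ x :: y :: s2) = (x :: y :: s2) ++ s1.
  by rewrite rot_size_cat.
rewrite -E rot_cycle rot_uniq; split=> //; last by rewrite !size_cat /=; lia.
by rewrite (eq_all_r (mem_rot _ _)).
Qed.

End Tournament.

(** * Vertex-pancyclicity of strong tournaments *)

(** Strength in terms of cuts, which supplies an arc leaving a chosen set without any path. *)
Definition strong_rel (T : finType) (e : rel T) : Prop := forall P : pred T,
  (exists x, P x) -> (exists x, ~~ P x) -> exists x y, [/\ P x, ~~ P y & e x y].

Section StrongTournament.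
Variables (T : finType) (e : rel T).
Hypotheses (tour : tournament e) (str : strong_rel e).

Lemma exists_notin (s : seq T) : size s < #|T| -> exists x, x \notin s.
Proof.
move=> sT; have /subsetPn[x _ xs]: ~~ ([set: T] \subset s).
  apply: contraL sT => /subset_leq_card; rewrite cardsT -leqNgt => /leq_trans -> //.
  exact: card_size.
by exists x.
Qed.

(** An arc that leaves the out-neighbourhood of [v] ends at an in-neighbour of [v]. *)
Lemma three_cycle v : 1 < #|T| -> exists x y, [/\ e v x, e x y & e y v].
Proof.
move=> T1; have [w wv] := exists_notin (T1 : size [:: v] < #|T|); rewrite inE in wv.
have [_ [x0 [/eqP-> _ evx0]]]: exists x y, [/\ x == v, y != v & e x y].
  by apply: (str (P := pred1 v)); [exists v => /= | exists w].
have [x [y [evx nevy exy]]]: exists x y, [/\ e v x, ~~ e v y & e x y].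
  by apply: (str (P := e v)); [exists x0 | exists v; case: tour => ->].
exists x, y; split=> //; apply: (narc tour) nevy.
by apply: contraTneq exy => <-; rewrite (arc_asym tour evx).
Qed.

(* If no outer vertex can be inserted, each of them dominates the cycle or is
   dominated by it; strength gives an arc [b -> a] from the second kind to the first,
   and the path [v -> b -> a] replaces one vertex of the cycle. *)
Lemma cycle_extend v s : cycle e s -> uniq s -> v \in s -> 3 <= size s < #|T| ->
  exists s', [/\ cycle e s', uniq s', v \in s' & size s' = (size s).+1].
Proof.
move=> cs us vs sizes; have [i p Es] := rot_to vs.
rewrite -(rot_cycle i) Es in cs; rewrite -(rot_uniq i) Es in us.
have {i vs Es}: 3 <= size (v :: p) < #|T| /\ size s = size (v :: p).
  by rewrite -Es size_rot.
case=> {}sizes ->; rewrite /= in cs.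
case: (pickP [pred w | (w \notin v :: p) && insertable e w (v :: rcons p v)]).
  move=> w /andP[wp iw]; have wr: w \notin v :: rcons p v.
    by rewrite inE mem_rcons negb_or wp andbT; case/norP: wp.
  have [q [pq lq eq _]] := insert_path tour cs wr iw.
  case/lastP: q pq lq eq => [|q z] pq; first by move=> _ /perm_size; rewrite /= size_rcons.
  rewrite !last_rcons => zv eq; subst z.
  have {}eq: perm_eq (v :: q) (v :: w :: p).
    apply: perm_trans (_ : perm_eq _ (rcons q v)) _; first by rewrite perm_sym perm_rcons.
    by apply: perm_trans eq _; rewrite -rcons_cons perm_rcons.
  exists (v :: q); split=> //; rewrite ?mem_head ?(perm_size eq) // (perm_uniq eq).
  move: wp us; rewrite /= !inE !negb_or eq_sym => /andP[-> ->] /andP[-> ->]; exact: isT.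
move=> noins.
have dom w : w \notin v :: p -> e w v -> {in v :: p, forall z, e w z}.
  move=> wp ewv z zp; have ni: insertable e w (v :: rcons p v) = false by move: (noins w); rewrite inE wp.
  case: (eqVneq z v) => [->//|zv]; apply/(narc tour); first by apply: contraNneq wp => <-.
  have zp': z \in p by move: zp; rewrite inE (negPf zv).
  apply/negP => ezw; case/splitPr: zp' ni => p1 p2.
  rewrite -cats1 -catA -cat_cons; move/negP; apply.
  by apply: (insertable_cat _ ezw _ ewv); rewrite mem_cat mem_seq1 eqxx orbT.
have domby w : w \notin v :: p -> e v w -> {in v :: p, forall z, e z w}.
  move=> wp evw z zp; have ni: insertable e w (v :: rcons p v) = false by move: (noins w); rewrite inE wp.
  case: (eqVneq z v) => [->//|zv]; apply: (narc tour); first by apply: contraNneq wp => ->.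
  have zp': z \in p by move: zp; rewrite inE (negPf zv).
  apply: contraFN ni => ewz; rewrite /= evw /=; apply/orP; left; apply/hasP; exists z => //.
  by rewrite mem_rcons inE zp' orbT.
have [w0 w0p] : exists w, w \notin v :: p by apply: exists_notin; case/andP: sizes.
have [x [y0 [xp y0p exy]]]: exists x y, [/\ x \in v :: p, y \notin v :: p & e x y].
  by apply: (str (P := mem (v :: p))); [exists v; exact: mem_head | exists w0].
have evy0 : e v y0.
  apply: contraT => nevy; have := dom y0 y0p (narc tour _ nevy) x xp.
  rewrite (arc_asym tour exy) => -> //.
  by apply: contraNneq y0p => <-; rewrite mem_head.
have [b [a [/andP[bp evb] nB eba]]]:
    exists b a, [/\ (b \notin v :: p) && e v b, ~~ ((a \notin v :: p) && e v a) & e b a].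
  apply: (str (P := fun b => (b \notin v :: p) && e v b)).
    by exists y0; rewrite y0p.
  by exists v; rewrite mem_head.
have ap: a \notin v :: p.
  by apply/negP => ap; have := domby b bp evb a ap; rewrite (arc_asym tour eba).
have eav: e a v.
  rewrite ap /= in nB; apply: (narc tour) nB.
  by apply: contraNneq ap => <-; rewrite mem_head.
case: p cs us sizes dom domby bp ap {noins w0p xp y0p nB}
  => [|z [|h p]] cs us sizes dom domby bp ap //.
exists [:: v, b, a, h & p]; split=> //.
- rewrite /= evb eba (dom a ap eav) ?inE ?eqxx ?orbT //=.
  by move: cs => /= /and3P[].
- move: us bp ap (arc_neq tour eba); rewrite /= !inE !negb_or.
  move=> /and3P[/and3P[_ vh vp] /andP[_ _] /andP[hp up]].
  move=> /and4P[bv _ bh bp] /and4P[av _ ah ap] ba.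
  by rewrite eq_sym bv eq_sym av vh vp ba bh bp ah ap hp up.
- by rewrite mem_head.
Qed.

Lemma strong_vertex_pancyclic v l : 3 <= l <= #|T| ->
  exists s, [/\ cycle e s, uniq s, v \in s & size s = l].
Proof.
elim: l => [//|l IH] /andP[l3 lT].
case: (ltnP 2 l) => l2.
  have [|s [cs us vs sl]] := IH; first by rewrite l2 ltnW.
  have [|s' [? ? ? ?]] := cycle_extend cs us vs; first by rewrite sl l2.
  by exists s'; rewrite -sl.
have ->: l = 2 by lia.
have [|x [y [evx exy eyv]]] := three_cycle v; first by lia.
exists [:: v; x; y]; split=> //=; first by rewrite evx exy eyv.
  by rewrite !inE negb_or (arc_neq tour evx) eq_sym (arc_neq tour eyv) (arc_neq tour exy).
by rewrite mem_head.
Qed.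

End StrongTournament.

(** * Pancyclic arcs of a Hamiltonian cycle of a tournament *)

(** Applied in [three_pan_back], where every pancyclic arc of a short cycle yields one of the long
    cycle and different arcs never yield the same one. *)
Lemma choose_distinct (I J : eqType) (R : I -> J -> Prop) (s : seq I) : uniq s ->
    (forall i, i \in s -> exists j, R i j) ->
    (forall i i' j, i \in s -> i' \in s -> R i j -> R i' j -> i = i') ->
  exists s', [/\ size s' = size s, uniq s' & forall j, j \in s' -> exists2 i, i \in s & R i j].
Proof.
elim: s => [|i s IH] /=; first by exists [::].
move=> /andP[is_ us] ex inj.
have [|i1 i2 j i1s i2s|s' [sz us' Rs']] := IH us.
- by move=> i1 i1s; apply: ex; rewrite inE i1s orbT.
- by apply: inj; rewrite inE ?i1s ?i2s orbT.
have [j Rij] := ex i (mem_head _ _).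
exists (j :: s'); split=> /=; first by rewrite sz.
- rewrite us' andbT; apply/negP => /Rs'[i' i's Ri'j].
  by move: is_; rewrite (inj i i' j) ?mem_head ?inE ?i's ?orbT.
- move=> j'; rewrite inE => /orP[/eqP->|/Rs'[i' i's Ri'j]].
    by exists i; rewrite ?mem_head.
  by exists i'; rewrite // inE i's orbT.
Qed.

Section Moon.
Variables (T : eqType) (e : rel T).
Hypothesis tour : tournament e.

(* A Hamiltonian cycle on [n] vertices, indexed by [nat] with period [n]; its arcs
   are the [v i -> v i.+1]. *)
Definition cyclic_seq (v : nat -> T) (n : nat) : Prop :=
  [/\ forall i, e (v i) (v i.+1), forall i, v (i + n) = v i
    & forall i j, v i = v j -> i = j %[mod n]].

Definition three_pan (D : {pred T}) (v : nat -> T) (n : nat) : Prop :=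
  exists s, [/\ 3 <= size s, uniq s
    & forall i, i \in s -> i < n /\ pan e D n (v i) (v i.+1)].

(** * Segments and cycles along an indexed Hamiltonian cycle *)

Section CyclicSeq.
Variables (v : nat -> T) (n : nat) (D : {pred T}).
Hypotheses (cv : cyclic_seq v n) (Dv : forall i, v i \in D).
Hypothesis n3 : 2 < n.

Lemma cyc_next i : e (v i) (v i.+1). Proof. by case: cv. Qed.
Lemma cyc_per i : v (i + n) = v i. Proof. by case: cv. Qed.
Lemma cyc_vn : v n = v 0. Proof. by rewrite -[LHS]/(v (0 + n)) cyc_per. Qed.

Lemma cyc_mod i : v (i %% n) = v i.
Proof.
rewrite [in RHS](divn_eq i n); elim: (i %/ n) => [|q IH]; first by rewrite mul0n add0n.
by rewrite mulSnr addnAC cyc_per.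
Qed.

Lemma cyc_eqmod i j : i = j %[mod n] -> v i = v j.
Proof. by rewrite -(cyc_mod i) -(cyc_mod j) => ->. Qed.

(** Any window of [n] consecutive indices is allowed, as segments may start anywhere; the window
    from 1 to [n] has [v n] in place of [v 0]. *)
Lemma cyc_inj a i j : a <= i < a + n -> a <= j < a + n -> v i = v j -> i = j.
Proof.
move=> ia ja vij; have: i = j %[mod n] by case: cv => _ _; apply.
have [i' Ei] : exists i', i = a + i' by exists (i - a); lia.
have [j' Ej] : exists j', j = a + j' by exists (j - a); lia.
subst i j => /eqP; rewrite eqn_modDl !modn_small; try lia.
Qed.

Lemma cyc_uniq a s : uniq s -> all (fun i => a <= i < a + n) s -> uniq (map v s).
Proof.
move=> us /allP as_; rewrite map_inj_in_uniq // => i j /as_ ia /as_ ja.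
exact: (cyc_inj ia ja).
Qed.

Lemma seg_path a b : path e (v a) (map v (iota a.+1 b)).
Proof. by elim: b a => [//|b IH] a /=; rewrite cyc_next IH. Qed.

Lemma seg_last a b : last (v a) (map v (iota a.+1 b)) = v (a + b).
Proof. by elim: b a => [|b IH] a /=; rewrite ?addn0 // IH addSnnS. Qed.

Lemma seg_all s : all [in D] (map v s).
Proof. by apply/allP => x /mapP[i _ ->]. Qed.

Lemma seg_cycle b L a : 1 < L < n -> e (v (b + L)) (v b) -> b <= a < b + L ->
  in_cycle e D L.+1 (v a) (v a.+1).
Proof.
move=> L1 eb ab.
have E: map v (iota b L.+1) =
    map v (iota b (a - b)) ++ v a :: v a.+1 :: map v (iota a.+2 (b + L - a.+1)).
  have -> : L.+1 = (a - b) + (b + L - a.+1).+2 by lia.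
  by rewrite iotaD map_cat subnKC //; case/andP: ab.
have := @in_cycle_mid _ e D (map v (iota b (a - b))) (v a) (v a.+1)
   (map v (iota a.+2 (b + L - a.+1))).
rewrite -E size_map size_iota; apply; last exact: seg_all.
  by rewrite /= rcons_path seg_path seg_last.
apply: (cyc_uniq (a := b)); first exact: iota_uniq.
by apply/allP => i; rewrite mem_iota; lia.
Qed.

Lemma full_cycle a : in_cycle e D n (v a) (v a.+1).
Proof.
have := @seg_cycle a n.-1 a; rewrite prednK; last by lia.
apply; try lia.
by rewrite -(cyc_per a) -[in v (a + n)](prednK (ltnW (ltnW n3))) addnS cyc_next.
Qed.

Lemma cyc_shift a : cyclic_seq (fun i => v (a + i)) n.
Proof.
split=> [i|i|i j vij]; rewrite ?addnS ?cyc_next // ?addnA ?cyc_per //.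
have /eqP: a + i = a + j %[mod n] by case: cv => _ _; apply.
by rewrite eqn_modDl => /eqP.
Qed.

Lemma three_pan_shift a : three_pan D (fun i => v (a + i)) n -> three_pan D v n.
Proof.
move=> [s [s3 us pans]]; exists [seq (a + i) %% n | i <- s]; split.
- by rewrite size_map.
- rewrite map_inj_in_uniq // => i j /pans[i_n _] /pans[j_n _] /eqP.
  by rewrite eqn_modDl !modn_small // => /eqP.
- move=> j /mapP[i /pans[i_n pi] ->]; split; first by rewrite ltn_mod; lia.
  rewrite cyc_mod; have -> // : v ((a + i) %% n).+1 = v (a + i).+1.
  by apply: cyc_eqmod; rewrite -addn1 modnDml addn1.
  by move: pi; rewrite addnS.
Qed.

End CyclicSeq.
End Moon.

Lemma count_iota_split (a : pred nat) N t : t < count a (iota 1 N) ->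
  exists j, [/\ 0 < j <= N, a j & count a (iota 1 j.-1) = t].
Proof.
elim: N => [//|N IH]; rewrite -[N.+1]addn1 iotaD count_cat /= add1n addn0 => lt.
case: (ltnP t (count a (iota 1 N))) => [/IH[j [jN aj cj]]|ge].
  by exists j; split=> //; lia.
case: (boolP (a N.+1)) lt => [aN|_] lt; last by lia.
by exists N.+1; split=> //=; lia.
Qed.

(** * A chord and the short cycle through it *)

Section Chord.
Variables (T : eqType) (e : rel T).
Hypothesis tour : tournament e.
Variables (v : nat -> T) (n d : nat) (D : {pred T}).
Hypotheses (cv : cyclic_seq e v n) (Dv : forall i, v i \in D).
Hypotheses (d1 : 1 < d) (dn : d.+1 < n) (chord : e (v 0) (v d)).
Let n3 : 2 < n. Proof. by lia. Qed.

(* The cycle that follows the chord [v 0 -> v d]; [outer] is its vertex set, with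
   [v 0] represented as [v n]. *)
Definition shortcut (k : nat) : T :=
  let r := k %% (n - d).+1 in if r == 0 then v 0 else v (d + r.-1).

Definition outer : {pred T} := [pred x | x \in map v (iota d (n - d).+1)].

Lemma outer_v i : d <= i <= n -> v i \in outer.
Proof. by move=> di; apply/map_f; rewrite mem_iota; lia. Qed.

Lemma outer_v0 : v 0 \in outer.
Proof. by rewrite -(cyc_vn cv) outer_v //; lia. Qed.

Lemma outer_sub : {subset outer <= D}.
Proof. by move=> x /mapP[i _ ->]. Qed.

Lemma inner_notin j : 0 < j < d -> v j \notin outer.
Proof.
move=> jd; apply/mapP => -[i]; rewrite mem_iota => ii /(cyc_inj (a := 1) cv n3).
by move=> H; have := H ltac:(lia) ltac:(lia); lia.
Qed.

Lemma shortcut0 : shortcut 0 = v 0.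
Proof. by rewrite /shortcut mod0n. Qed.

Lemma shortcutE k : 0 < k <= n - d -> shortcut k = v (d + k.-1).
Proof. by move=> kn; rewrite /shortcut modn_small; [case: eqP => //; lia|lia]. Qed.

Lemma shortcutS k : 0 < k <= n - d -> shortcut k.+1 = v (d + k).
Proof.
move=> kn; case: (ltnP k (n - d)) => kn'; first by rewrite shortcutE //; lia.
have -> : k = n - d by lia.
rewrite /shortcut modnn /= -(cyc_vn cv); congr v; lia.
Qed.

Lemma shortcut_outer k : shortcut k \in outer.
Proof.
rewrite /shortcut; case: eqP => [_|r0]; first exact: outer_v0.
have := ltn_pmod k (ltn0Sn (n - d)); move: r0; set r := k %% _ => r0 rn.
by apply: outer_v; lia.
Qed.

Lemma shortcut_cyclic : cyclic_seq e shortcut (n - d).+1.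
Proof.
have lt k : k %% (n - d).+1 < (n - d).+1 by rewrite ltn_mod.
split=> [k|k|i j].
- have -> : shortcut k = shortcut (k %% (n - d).+1) by rewrite /shortcut modn_mod.
  have -> : shortcut k.+1 = shortcut (k %% (n - d).+1).+1.
    by rewrite /shortcut -[in RHS]addn1 modnDml addn1.
  have := lt k; set r := k %% _ => rn; case: (posnP r) => [->|r0].
    by rewrite shortcut0 shortcutE ?addn0 //; lia.
  rewrite shortcutE ?shortcutS //; try lia.
  by have := cyc_next cv (d + r.-1); rewrite -addnS prednK.
- by rewrite /shortcut modnDr.
- rewrite /shortcut; have := lt i; have := lt j.
  set r := i %% _; set r' := j %% _ => rn rn'.
  rewrite -(cyc_vn cv); case: eqP => [->|r0]; case: eqP => [->|r'0] // E;
    by have := cyc_inj (a := 1) cv n3 _ _ E; lia.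
Qed.

(** Replacing the chord by the path [v 0, .., v d] adds [d - 1] vertices, so the lengths from 3 to
    [n - d + 1] become those from [d + 2] to [n]. *)
Lemma via_chord j L : j < d -> pan e outer (n - d).+1 (v 0) (v d) -> d.+1 < L <= n ->
  in_cycle e D L (v j) (v j.+1).
Proof.
move=> jd pg Ld; have [|p [cp up ap sp]] := pg (L - d.-1); first by lia.
have E : v 0 :: map v (iota 1 d.-1) ++ v d :: p =
    map v (iota 0 j) ++ v j :: v j.+1 :: (map v (iota j.+2 (d - j.+1)) ++ p).
  rewrite -cat_cons -[v 0 :: _]/(map v (iota 0 d.-1.+1)) prednK; last by lia.
  rewrite -cat_rcons -map_rcons.
  have -> : rcons (iota 0 d) d = iota 0 d.+1 by rewrite -addn1 iotaD cats1.
  have -> : d.+1 = j + (d - j.+1).+2 by lia.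
  by rewrite iotaD map_cat -catA.
have := @in_cycle_mid _ e D (map v (iota 0 j)) (v j) (v j.+1)
   (map v (iota j.+2 (d - j.+1)) ++ p).
rewrite -E => H; have -> : L = size (v 0 :: map v (iota 1 d.-1) ++ v d :: p).
  by rewrite /= size_cat /= size_map size_iota; lia.
apply: H.
- move: cp; rewrite /= rcons_cat cat_path (seg_path cv) /= => /andP[_ ->].
  rewrite andbT (seg_last v 0) -{2}[d](prednK (ltnW d1)) add0n; exact: cyc_next cv _.
- have E2 : perm_eq ([:: v 0] ++ map v (iota 1 d.-1) ++ v d :: p)
     (map v (iota 1 d.-1) ++ v 0 :: v d :: p) by apply/permPl/(perm_catCA [:: v 0]).
  rewrite (perm_uniq E2) cat_uniq up andbT (cyc_uniq (a := 1) cv n3) ?iota_uniq //; last first.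
    by apply/allP => i; rewrite mem_iota; lia.
  apply/hasPn => x /(allP ap) xo; apply/mapP => -[i]; rewrite mem_iota => ii xi.
  by have /negP[] : v i \notin outer by [apply: inner_notin; lia]; rewrite -xi.
- rewrite -cat_cons all_cat (seg_all Dv (iota 0 d.-1.+1)) /=.
  by move: ap => /= /and3P[_ /outer_sub -> /allP ap]; apply/allP => x /ap /outer_sub.
Qed.

Let full_n a : in_cycle e D n (v a) (v a.+1) := full_cycle cv Dv n3 a.

(* If the chord is pancyclic in the short cycle, replacing it by the two arcs it cuts
   off gives the lengths [4..n] for both, and one of them lies in a 3-cycle. *)
Lemma three_pan_chord2 : d = 2 ->
  three_pan e outer shortcut (n - d).+1 -> three_pan e D v n.
Proof.
move=> d2 [s [s3 us pans]].
have lift k : k \in s -> k != 0 -> k.+1 < n /\ pan e D n (v k.+1) (v k.+2).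
  move=> ks k0; have [kn pk] := pans k ks; split; first by lia.
  move: pk; rewrite shortcutE ?shortcutS; try lia.
  have -> : d + k.-1 = k.+1 by lia.
  have -> : d + k = k.+2 by lia.
  move=> pk l ln; case: (eqVneq l n) => [->|nl]; first exact: full_n.
  by apply: in_cycle_sub outer_sub (pk l _); lia.
case: (boolP (0 \in s)) => s0; last first.
  exists (map S s); split; rewrite ?size_map ?(map_inj_uniq succn_inj) //.
  move=> _ /mapP[k ks ->]; apply: lift => //.
  by apply: contraNneq s0 => <-.
have [_ pg] := pans 0 s0; rewrite shortcut0 shortcutE ?addn0 // in pg; last by lia.
(* The third vertex [w] of a triangle on the chord forms a triangle with [v 0 -> v 1] if [v 1 -> w],
   and with [v 1 -> v 2] otherwise. *)
have [i [i1 pi]] : exists i, i < 2 /\ in_cycle e D 3 (v i) (v i.+1).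
  have [|p [cp up ap sp]] := pg 3; first by lia.
  case: p cp up ap sp => [|w [|? ?]] cp up ap sp; [by [] | | by move: sp => /=; lia].
  move: cp; rewrite /= !andbT => /and3P[_ e2w ew0].
  have wo: w \in outer by move: ap => /and4P[].
  have wD := outer_sub wo.
  have w1: v 1 != w by apply: contraTneq wo => <-; apply: inner_notin; lia.
  have := up; rewrite /= !inE negb_or => /and3P[/andP[v02 v0w] v2w _].
  have e01 := cyc_next cv 0; have e12 := cyc_next cv 1; rewrite -d2 in e12.
  case: (boolP (e (v 1) w)) => e1w.
    exists 0; split=> //; exists [:: w]; split; rewrite //= ?Dv ?wD ?e01 ?e1w ?ew0 //.
    by rewrite !inE negb_or w1 v0w (arc_neq tour e01).
  have ew1 := narc tour w1 e1w.
  exists 1; split=> //; exists [:: w]; rewrite -d2; split; rewrite //= ?Dv ?wD ?e12 ?ew1 ?e2w //.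
  by rewrite !inE negb_or w1 v2w (arc_neq tour e12).
exists (i :: map S (rem 0 s)); split.
- by rewrite /= size_map size_rem //; lia.
- rewrite /= map_inj_uniq ?rem_uniq //; last exact: succn_inj.
  rewrite andbT; apply/mapP => -[k]; rewrite mem_rem_uniq // !inE => /andP[k0 _]; lia.
- move=> j; rewrite inE => /orP[/eqP ->|/mapP[k]].
    split; first by lia.
    move=> l l3; case: (eqVneq l 3) => [->//|nl3]; apply: via_chord => //; lia.
  rewrite mem_rem_uniq // !inE => /andP[k0 ks] ->; exact: lift.
Qed.

(** * Shortest chords: arcs of the cycle found by inserting the inner vertices *)

Hypotheses (d2 : 2 < d) (back : forall i L, 1 < L < d -> e (v (i + L)) (v i)).

Let backE i j : i + 1 < j < i + d -> e (v j) (v i).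
Proof. by move=> ij; have := @back i (j - i); rewrite subnKC; [apply; lia|lia]. Qed.

Let inj i j : 0 < i <= n -> 0 < j <= n -> v i = v j -> i = j.
Proof. by move=> ii jj; apply: (cyc_inj (a := 1) cv n3); lia. Qed.

Let neq i j : 0 < i <= n -> 0 < j <= n -> i != j -> v i != v j.
Proof. by move=> ii jj; apply: contraNneq => /(inj ii jj) ->. Qed.

Let uniq_v s : uniq s -> all (fun i => 0 < i <= n) s -> uniq (map v s).
Proof. by move=> us /allP a; apply: (cyc_uniq (a := 1) cv n3 us); apply/allP => i /a. Qed.

(* Indices of the short cycle cut open at the arc [v s -> v s.+1]. *)
Definition opened (s : nat) : seq nat := iota s.+1 (n - s) ++ iota d (s - d).+1.

Let openedE s : d <= s < n ->
  map v (opened s) = v s.+1 :: map v (iota s.+2 (n - s).-1 ++ iota d (s - d).+1).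
Proof. by move=> ds; rewrite /opened; have -> : n - s = (n - s).-1.+1 by lia. Qed.

Let opened_rcons s : d <= s < n ->
  map v (opened s) = rcons (map v (iota s.+1 (n - s) ++ iota d (s - d))) (v s).
Proof.
move=> ds; rewrite /opened -map_rcons rcons_cat; congr (map v (_ ++ _)).
by rewrite -addn1 iotaD /= cats1; congr (rcons _ _); lia.
Qed.

Let mem_opened s i : d <= s < n -> (i \in opened s) = (d <= i <= n).
Proof. by move=> ds; rewrite mem_cat !mem_iota; lia. Qed.

Let uniq_opened s : d <= s < n -> uniq (opened s).
Proof.
move=> ds; rewrite cat_uniq !iota_uniq andbT; apply/hasPn => i.
by rewrite !mem_iota; lia.
Qed.

Let size_opened s : d <= s < n -> size (opened s) = (n - d).+1.
Proof. by move=> ds; rewrite size_cat !size_iota; lia. Qed.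

Let path_opened s : d <= s < n ->
  path e (v s.+1) (map v (iota s.+2 (n - s).-1 ++ iota d (s - d).+1)).
Proof.
move=> ds; rewrite map_cat cat_path (seg_path cv) seg_last /=.
have -> : s.+1 + (n - s).-1 = n by lia.
by rewrite (cyc_vn cv) chord (seg_path cv).
Qed.

Let last_opened s : d <= s < n ->
  last (v s.+1) (map v (iota s.+2 (n - s).-1 ++ iota d (s - d).+1)) = v s.
Proof. by move=> ds; rewrite map_cat last_cat /= seg_last; congr v; lia. Qed.

Let notin_opened s j : d <= s < n -> 0 < j < d -> v j \notin map v (opened s).
Proof.
move=> ds jd; apply/mapP => -[i]; rewrite mem_opened // => di /inj.
by move=> H; have := H ltac:(lia) ltac:(lia); lia.
Qed.

(* [v j] has both in- and out-neighbours on the short cycle, so it can only be stuck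
   if its unique place is at the arc [v s -> v s.+1] itself. *)
Definition stuck (s j : nat) : bool := ~~ insertable e (v j) (map v (opened s)).

Lemma stuck_arcs s j : d <= s < n -> 0 < j < d -> stuck s j ->
  e (v j) (v s.+1) /\ e (v s) (v j).
Proof.
move=> ds jd st; have nin := notin_opened ds jd.
have vin i : d <= i <= n -> v i \in map v (opened s).
  by move=> di; rewrite map_f // mem_opened.
split.
  (* Backward arcs shorter than [d] reach the short cycle: [v j -> v n] for [j > 1], and
     [v 1 -> v n.-1] because [2 < d]. Likewise [v d] or [v d.+1] is an in-neighbour below. *)
  have [i di eji] : exists2 i, d <= i <= n & e (v j) (v i).
    case: (ltnP 1 j) => j1.
      by exists n; [lia|rewrite (cyc_vn cv); apply: backE; lia].
    have -> : j = 1 by lia.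
    exists n.-1; first by lia.
    have -> : v 1 = v (n.-1 + 2) by rewrite -(cyc_per cv 1); congr v; lia.
    by apply: back; lia.
  have := vin i di; move: st nin; rewrite /stuck openedE // => st nin vi.
  exact: (not_insertable_head tour nin st eji vi).
have [i di eij] : exists2 i, d <= i <= n & e (v i) (v j).
  case: (ltnP j.+1 d) => j1; first by exists d; [lia | apply: backE; lia].
  by exists d.+1; [lia | apply: backE; lia].
have := vin i di; move: st nin; rewrite /stuck opened_rcons // => st nin vi.
exact: (not_insertable_last tour nin st eij vi).
Qed.

(** The arcs of [stuck_arcs] make room for [v j] between [v s'] and [v s'.+1], which are consecutive
    in every other opening. *)
Lemma stuck_uniq s s' j : d <= s < n -> d <= s' < n -> 0 < j < d ->
  stuck s j -> stuck s' j -> s = s'.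
Proof.
wlog ss' : s s' / s < s'.
  move=> W ds ds' jd st st'; case: (ltngtP s s') => // c; first exact: W st st'.
  by apply/esym; apply: W st' st.
move=> ds ds' jd st st'; have [e1 _] := stuck_arcs ds' jd st'.
have [_ e2] := stuck_arcs ds' jd st'.
case/negP: st; rewrite /opened.
have -> : n - s = (s' - s.+1) + (n - s').-1.+2 by lia.
rewrite iotaD /= -catA map_cat /=.
have -> : s.+1 + (s' - s.+1) = s' by lia.
by apply: (insertable_cat _ e2 _ e1); rewrite mem_head.
Qed.

Let insert_cycle y p x W : path e y p -> last y p = x -> e x y ->
  uniq (W ++ y :: p) -> all (insertable e ^~ (y :: p)) W -> all [in D] (W ++ y :: p) ->
  in_cycle e D (size W + (size p).+1) x y.
Proof.
move=> pp lp exy uW iW aW; have [q [pq lq eq]] := insert_seq tour pp uW iW.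
have {}eq : perm_eq (y :: q) (W ++ y :: p).
  rewrite perm_sym -cat1s perm_catCA /= perm_cons perm_sym; exact: eq.
have -> : size W + (size p).+1 = (size q).+1.
  by rewrite -[RHS]/(size (y :: q)) (perm_size eq) size_cat.
apply: (in_cycle_path tour pq); rewrite ?lq ?lp //.
  by rewrite (perm_uniq eq).
by rewrite (perm_all _ eq).
Qed.

Lemma inner_short j l : 0 < j -> j.+1 < d -> 2 < l <= d.+1 -> in_cycle e D l (v j) (v j.+1).
Proof.
move=> j0 jd ld; case: (ltnP d l) => dl; last first.
  have -> : l = l.-1.+1 by lia.
  by apply: (seg_cycle cv Dv n3 (b := j)); [lia | apply: back; lia | lia].
(* For the length [d + 1]: [v 0 -> v d -> v 1 -> .. -> v d.-1 -> v 0], with the chord and two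
   backward arcs of length [d - 1]. *)
have -> : l = size ((v n :: v d :: map v (iota 1 j.-1)) ++
    v j :: v j.+1 :: map v (iota j.+2 (d - j.+2))).
  by rewrite size_cat /= !size_map !size_iota; lia.
have E : (v n :: v d :: map v (iota 1 j.-1)) ++
    v j :: v j.+1 :: map v (iota j.+2 (d - j.+2)) = map v (n :: d :: iota 1 d.-1).
  have -> : d.-1 = j.-1 + (d - j.+2).+2 by lia.
  by rewrite /= iotaD map_cat /= add1n prednK.
apply: in_cycle_mid; rewrite E.
- rewrite (cycle_path (v n)) -[X in last _ X]/(map v (n :: d :: iota 1 d.-1)).
  have -> : d.-1 = d.-2.+1 by lia.
  rewrite /= (cyc_vn cv) chord (backE (i := 1)) ?(seg_path cv) ?seg_last /=; last by lia.
  by rewrite !andbT -(cyc_vn cv); rewrite (cyc_vn cv); apply: backE; lia.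
- apply: uniq_v; first by rewrite /= !inE !mem_iota iota_uniq; lia.
  by apply/allP => i; rewrite !inE mem_iota; lia.
- exact: seg_all.
Qed.

(* The arc [v j -> v j.+1] is put in place of [v s -> v s.+1] in the cycles through
   the latter. *)
Lemma pan_inner s j : d <= s < n -> 0 < j -> j.+1 < d ->
    pan e outer (n - d).+1 (v s) (v s.+1) -> e (v s) (v j) -> e (v j.+1) (v s.+1) ->
  pan e D n (v j) (v j.+1).
Proof.
move=> ds j0 jd ps esj ejs l ln.
case: (ltnP d.+1 l) => dl'; last by apply: inner_short; lia.
have ej := cyc_next cv j.
case: (ltnP (n - d).+3 l) => lm; last first.
  have [|p [cp up ap sp]] := ps (l - 2); first by lia.
  have -> : l = size ([::] ++ v j :: v j.+1 :: v s.+1 :: rcons p (v s)).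
    by rewrite /= size_rcons; lia.
  apply: in_cycle_mid => /=.
  - move: cp; rewrite /= ej ejs /= => /andP[_].
    by rewrite !rcons_path last_rcons esj => ->.
  - have io := inner_notin; have ij: v j \notin outer by apply: io; lia.
    have ij1: v j.+1 \notin outer by apply: io; lia.
    have sub x : x \in v s.+1 :: rcons p (v s) -> x \in outer.
      by rewrite -rcons_cons mem_rcons; apply: (allP ap).
    rewrite !inE !negb_or (arc_neq tour ej) /=.
    have := contra (@sub _) ij; have := contra (@sub _) ij1.
    rewrite !inE !negb_or => -> ->.
    have {}up : uniq (rcons (v s.+1 :: p) (v s)) by rewrite rcons_uniq.
    exact: up.
  - rewrite !Dv /= all_rcons Dv /=.
    by move: ap => /= /and3P[_ _ /allP ap]; apply/allP => x /ap /outer_sub.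
have so := size_opened ds.
(* Longer cycles contain the whole short cycle, opened at [s] and closed through [v j -> v j.+1];
   the missing length is made up by other inner vertices. *)
pose us := [seq i <- iota 1 d.-1 | (i != j) && (i != j.+1)].
have sus : size us = d.-1 - 2.
  rewrite size_filter.
  have -> : d.-1 = j.-1 + (d - j.+2).+2 by lia.
  rewrite iotaD count_cat /= add1n prednK // eqxx /= eqxx andbF /=.
  rewrite !(eq_in_count (a2 := xpredT)) ?count_predT ?size_iota; first by lia.
    by move=> i; rewrite mem_iota; lia.
  by move=> i; rewrite mem_iota; lia.
pose W := map v (take (l - (n - d).+3) us).
have sW : size W = l - (n - d).+3 by rewrite size_map size_takel // sus; lia.
pose p := rcons (map v (opened s)) (v j).
have -> : l = size W + (size p).+1 by rewrite sW size_rcons size_map so; lia.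
have mu i : i \in take (l - (n - d).+3) us -> [/\ 0 < i < d, i != j & i != j.+1].
  by move=> /mem_take; rewrite mem_filter mem_iota => /andP[/andP[-> ->]] ?; split=> //; lia.
apply: insert_cycle => //; rewrite ?/p ?last_rcons //.
- rewrite rcons_path openedE //= ejs path_opened // last_opened //.
- have -> : W ++ v j.+1 :: rcons (map v (opened s)) (v j) =
      map v (take (l - (n - d).+3) us ++ j.+1 :: rcons (opened s) j).
    by rewrite /W -map_rcons -map_cons -map_cat.
  apply: uniq_v.
    rewrite cat_uniq take_uniq ?filter_uniq ?iota_uniq //= rcons_uniq uniq_opened //.
    rewrite !(mem_rcons, inE, mem_opened) //.
    have -> /= : (has (mem (take (l - (n - d).+3) us)) (rcons (opened s) j)) = false.
      apply/hasP => -[i]; rewrite mem_rcons inE mem_opened // => ii /mu[]; lia.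
    case: (boolP (j.+1 \in _)) => [/mu[]|_]; lia.
  apply/allP => i; rewrite mem_cat !(mem_rcons, inE, mem_opened) //.
  by move=> /orP[/mu[]|]; lia.
- apply/allP => x /mapP[i /mu[id_ ij ij1] ->].
  (* A stuck [v i] fits at one of the new ends: [v j.+1 -> v i -> v s.+1] if [i < j], and
     [v s -> v i -> v j] if [i > j.+1]. *)
  case: (boolP (stuck s i)) => st.
    have [e1 e2] := stuck_arcs ds id_ st; case: (ltngtP i j) => [lt|gt|/eqP]; last by rewrite (negPf ij).
      have ei : e (v j.+1) (v i) by apply: backE; lia.
      rewrite /= ei /= openedE //=; apply/orP; left; by rewrite e1.
    have ei : e (v i) (v j) by apply: backE; lia.
    rewrite opened_rcons // -!cats1 -catA -cat_cons.
    by apply: (insertable_cat _ e2 _ ei); rewrite mem_head.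
  move: st; rewrite /stuck negbK; apply: insertable_subseq.
  by apply: subseq_trans (subseq_rcons _ _) (subseq_cons _ _).
- have -> : W ++ v j.+1 :: rcons (map v (opened s)) (v j) =
      map v (take (l - (n - d).+3) us ++ j.+1 :: rcons (opened s) j).
    by rewrite /W -map_rcons -map_cons -map_cat.
  exact: seg_all.
Qed.

(* The vertices that are not stuck are inserted one by one. If [i] is the first stuck
   index and [j] a later one, then [v i, .., v j.-1] enters as a block just before
   [v s], so that all stuck vertices but the last can be used. *)
Lemma pan_outer s : d <= s < n -> pan e outer (n - d).+1 (v s) (v s.+1) ->
    (forall j, 0 < j -> j.+1 < d -> stuck s j.+1 -> ~~ e (v s) (v j)) ->
  pan e D n (v s) (v s.+1).
Proof.
move=> ds ps nost l ln.
case: (ltnP (n - d).+1 l) => lm; last first.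
  by apply: in_cycle_sub outer_sub (ps l _); lia.
case: (eqVneq l n) => [->|nl]; first exact: full_n.
have es := cyc_next cv s.
pose free := predC (stuck s).
have cfree a N : count free (iota a N) + count (stuck s) (iota a N) = N.
  by rewrite addnC count_predC size_iota.
have freeP w : free w -> insertable e (v w) (map v (opened s)) by rewrite /free /= negbK.
case: (leqP (l - (n - d).+1) (count free (iota 1 d.-1))) => cl.
  pose is_ := take (l - (n - d).+1) (filter free (iota 1 d.-1)).
  have sis : size is_ = l - (n - d).+1 by rewrite size_takel // size_filter.
  have mis i : i \in is_ -> free i /\ 0 < i < d.
    by move=> /mem_take; rewrite mem_filter mem_iota => /andP[fi ii]; split=> //; lia.
  have uis : uniq is_ by rewrite take_uniq ?filter_uniq ?iota_uniq.
  have -> : l = size (map v is_) + (size (map v (iota s.+2 (n - s).-1 ++ iota d (s - d).+1))).+1.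
    by rewrite !size_map sis size_cat !size_iota; lia.
  have E : map v is_ ++ v s.+1 :: map v (iota s.+2 (n - s).-1 ++ iota d (s - d).+1) =
      map v (is_ ++ opened s) by rewrite -openedE // -map_cat.
  apply: insert_cycle; rewrite ?E ?path_opened ?last_opened //.
  - apply: uniq_v.
      rewrite cat_uniq uis uniq_opened // andbT; apply/hasPn => i.
      by rewrite mem_opened // => ii; apply/negP => /mis[_]; lia.
    by apply/allP => i; rewrite mem_cat mem_opened // => /orP[/mis[_]|]; lia.
  - by apply/allP => x /mapP[i /mis[fi _] ->]; rewrite -openedE //; apply: freeP.
  - exact: seg_all.
(* This many stuck vertices are needed beyond the free ones. Exactly [t] stuck indices lie below [j]
   and none below [i], so the block from [i] to [j.-1] contains just these. *)
pose t := l - (n - d).+1 - count free (iota 1 d.-1).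
have [|j [j0 stj cj]] := @count_iota_split (stuck s) d.-1 t.
  by have := cfree 1 d.-1; rewrite /t; lia.
have [|i [i0 sti ci]] := @count_iota_split (stuck s) j.-1 0; first by rewrite cj /t; lia.
pose is_ := filter free (iota 1 i.-1 ++ iota j.+1 (d.-1 - j)).
have sis : size is_ + (j - i) = l - (n - d).+1.
  rewrite size_filter count_cat; have := cfree 1 i.-1; rewrite ci.
  have E: count free (iota 1 d.-1) = count free (iota 1 j.-1) + count free (iota j.+1 (d.-1 - j)).
    have -> : d.-1 = j.-1 + (d.-1 - j).+1 by lia.
    rewrite iotaD count_cat /= add1n prednK; last by lia.
    by rewrite /free /= stj; congr (_ + count _ (iota _ _)); lia.
  by have := cfree 1 j.-1; rewrite cj /t E; lia.
have mis w : w \in is_ -> free w /\ (0 < w < i \/ j < w < d).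
  rewrite mem_filter mem_cat !mem_iota => /andP[fw ww]; split=> //.
  by case/orP: ww => ww; [left|right]; lia.
have uis : uniq is_.
  rewrite filter_uniq // cat_uniq !iota_uniq andbT; apply/hasPn => w.
  by rewrite !mem_iota; lia.
(* The predecessor of [v s] on the short cycle, after which the block is placed. *)
pose zi := if d < s then s.-1 else n.
have ezi : e (v zi) (v i).
  rewrite /zi; case: ltnP => c.
    case: (eqVneq s d.+1) => [->|sd] /=; first by apply: backE; lia.
    move: sti; rewrite /stuck /opened map_cat /= => sti.
    apply: (not_insertable_in tour _ sti (z := v d)).
    - by have := @notin_opened s i ds; rewrite /opened map_cat; apply; lia.
    - by apply: backE; lia.
    - by rewrite map_f // mem_iota; lia.
  (* This case is contradictory: [v d.+1 -> v j] and [j] stuck at [d] would give [v n -> v j],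
     against the backward arc [v j -> v 0]. *)
  have {c}sd : s = d by lia.
  have ej : e (v d.+1) (v j) by apply: backE; lia.
  have := arc_asym tour (@backE 0 j ltac:(lia)); rewrite -(cyc_vn cv).
  move: stj; rewrite /stuck /opened sd.
  have nd : n - d = (n - d).-1.+1 by lia.
  rewrite nd map_cat /= => stj.
  rewrite (not_insertable_in tour _ stj (s1 := [::]) ej) //.
    by have := @notin_opened d j; rewrite /opened nd map_cat /=; apply; lia.
  by rewrite mem_cat map_f // mem_iota; lia.
have ejs : e (v j.-1) (v s).
  apply: (narc tour); last by apply: nost; rewrite ?prednK //; lia.
  by rewrite neq; lia.
pose q := iota s.+2 (n - s).-1 ++ iota d (s - d).
have sq : s.+1 :: q = iota s.+1 (n - s) ++ iota d (s - d).
  by rewrite /q; have -> : n - s = (n - s).-1.+1 by lia.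
have lq : last (v s.+1) (map v q) = v zi.
  rewrite map_cat last_cat seg_last /zi; have -> : s.+1 + (n - s).-1 = n by lia.
  case: ltnP => c; last by have -> : s - d = 0 by lia.
  by have -> : s - d = (s - d).-1.+1 by [lia]; rewrite /= seg_last; congr v; lia.
have pq : path e (v s.+1) (map v q).
  rewrite map_cat cat_path (seg_path cv) seg_last; have -> : s.+1 + (n - s).-1 = n by lia.
  case: (s - d) => [//|w] /=; by rewrite (cyc_vn cv) chord (seg_path cv).
have sE : map v is_ ++ v s.+1 :: map v (q ++ iota i (j - i) ++ [:: s]) =
  map v (is_ ++ s.+1 :: q ++ iota i (j - i) ++ [:: s]) by rewrite [RHS]map_cat.
have -> : l = size (map v is_) + (size (map v (q ++ iota i (j - i) ++ [:: s]))).+1.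
  by rewrite !size_map !size_cat !size_iota /=; lia.
apply: insert_cycle => //; rewrite ?sE.
- rewrite map_cat cat_path pq lq map_cat cat_path.
  have -> : j - i = (j - i).-1.+1 by lia.
  rewrite /= ezi (seg_path cv) seg_last /= andbT; move: ejs; congr (e (v _) _); lia.
- by rewrite !map_cat !last_cat.
- apply: uniq_v.
    rewrite -[_ :: q ++ _]cat_cons sq !cat_uniq uis !iota_uniq /=.
    have dis (l1 l2 : seq nat) : (forall w, w \in l1 -> w \in l2 -> False) -> ~~ has (mem l1) l2.
      by move=> l12; apply/hasPn => w w2; apply/negP => w1; apply: l12 w1 w2.
    have sij : (s \in iota i (j - i)) = false by rewrite mem_iota; lia.
    rewrite !dis ?sij // => w; try (move=> /mis[_] ?); rewrite !(mem_cat, mem_iota, inE); lia.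
  apply/allP => w; rewrite mem_cat -cat_cons sq !mem_cat !mem_iota inE.
  by case/orP=> [/mis[_]|]; lia.
- apply/allP => x /mapP[w /mis[fw _] ->].
  apply: insertable_subseq (freeP _ fw); rewrite -[v s.+1 :: _]/(map v (s.+1 :: q ++ _)).
  rewrite -cat_cons sq /opened; apply: map_subseq.
  have -> : iota d (s - d).+1 = iota d (s - d) ++ [:: s].
    by rewrite -addn1 iotaD /=; congr (_ ++ [:: _]); lia.
  rewrite catA; apply: cat_subseq => //; exact: suffix_subseq.
- exact: seg_all.
Qed.

(** By [pan_outer], a pancyclic arc [v s -> v s.+1] of the short cycle remains pancyclic unless
    [v s -> v j] for some stuck [v j.+1]; in that case [pan_inner] gives the arc [v j -> v j.+1]
    instead. These substitutes are distinct by [stuck_uniq]. *)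
Lemma three_pan_back : three_pan e outer shortcut (n - d).+1 ->
  three_pan e D v n \/ pan e outer (n - d).+1 (v 0) (v d).
Proof.
move=> [s [s3 us pans]]; case: (boolP (0 \in s)) => s0.
  right; have [_] := pans 0 s0; rewrite shortcut0 shortcutE ?addn0 //; lia.
left; pose R k j := [/\ j < n, pan e D n (v j) (v j.+1)
  & j = d + k.-1 \/ [/\ 0 < j, j.+1 < d & stuck (d + k.-1) j.+1]].
have kP k : k \in s -> 0 < k < (n - d).+1 /\ pan e outer (n - d).+1 (v (d + k.-1)) (v (d + k.-1).+1).
  move=> ks; have [kn pk] := pans k ks.
  have k0 : 0 < k by rewrite lt0n; apply: contraNneq s0 => <-.
  split; first by rewrite k0.
  move: pk; rewrite shortcutE ?shortcutS; try lia.
  by have -> : (d + k.-1).+1 = d + k by lia.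
have [k ks|k k' j ks k's|s' [ss' us' Rs']] := choose_distinct (R := R) us.
- have [kn pk] := kP k ks.
  case: (boolP (has (fun j => [&& 0 < j, j.+1 < d, stuck (d + k.-1) j.+1
      & e (v (d + k.-1)) (v j)]) (iota 0 d))) => [/hasP[j _ /and4P[j0 jd st ej]]|/hasPn no].
    exists j; split; [lia | | by right].
    apply: pan_inner pk ej _; try lia.
    by have [] := @stuck_arcs (d + k.-1) j.+1 _ _ st; lia.
  exists (d + k.-1); split; [lia | | by left].
  apply: pan_outer => //; first by lia.
  move=> j j0 jd st; have := no j; rewrite mem_iota j0 jd st /=; apply; lia.
- have [[kn _] [k'n _]] := (kP k ks, kP k' k's).
  move=> [_ _ Rj] [_ _ Rj'].
  case: Rj Rj' => [->|[j0 jd st]] [|[j0' jd' st']]; try lia.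
  have := @stuck_uniq (d + k.-1) (d + k'.-1) j.+1; lia.
- exists s'; split=> //; first by rewrite ss'.
  by move=> j /Rs'[k ks []].
Qed.

(** * Chords that are pancyclic in their short cycle *)

Section ChordPan.
Hypothesis pan_chord : pan e outer (n - d).+1 (v 0) (v d).

Lemma chord_inner j : 0 < j -> j.+1 < d -> pan e D n (v j) (v j.+1).
Proof.
move=> j0 jd l ln; case: (ltnP d.+1 l) => dl; last by apply: inner_short; lia.
by apply: via_chord => //; lia.
Qed.

(** Backward arcs give the lengths up to [d], and [via_chord] those above [d + 1]; the hypothesis
    provides the arc that closes a segment of [d + 1] vertices. *)
Lemma chord_last : ~~ e (v d.-1) (v (d.-1 + d)) -> pan e D n (v d.-1) (v d).
Proof.
move=> ne l ln; have dd : (d.-1).+1 = d by lia.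
rewrite -[X in in_cycle _ _ _ _ (v X)]dd.
case: (ltnP d.+1 l) => dl; first by apply: via_chord => //; lia.
have -> : l = l.-1.+1 by lia.
apply: (seg_cycle cv Dv n3 (b := d.-1)); [lia | | lia].
case: (eqVneq l d.+1) => [-> | ld]; last by apply: back; lia.
apply: (narc tour) ne; apply/eqP => /(cyc_inj (a := d.-1) cv n3); lia.
Qed.

(** Mirror image of [chord_last]: the chord excluded here would end at [v n.+1], which is [v 1]. *)
Lemma chord_first : ~~ e (v (n.+1 - d)) (v (n.+1 - d + d)) -> pan e D n (v 0) (v 1).
Proof.
move=> ne l ln; case: (ltnP d.+1 l) => dl; first by apply: via_chord => //; lia.
have -> : l = l.-1.+1 by lia.
case: (eqVneq l d.+1) => [-> | ld]; last first.
  by apply: (seg_cycle cv Dv n3 (b := 0)); [lia | apply: back; lia | lia].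
rewrite -(cyc_vn cv) -(cyc_per cv 1) add1n.
apply: (seg_cycle cv Dv n3 (b := n.+1 - d)); [lia | | lia].
apply: (narc tour) ne; apply/eqP => /(cyc_inj (a := n.+1 - d) cv n3); lia.
Qed.

End ChordPan.

End Chord.

Section MoonTheorem.
Variables (T : eqType) (e : rel T).
Hypothesis tour : tournament e.

(* Induction on [n], with a shortest chord [v i -> v (i + d)]. If it is not among the
   three pancyclic arcs of its short cycle, these lead to three pancyclic arcs of [v].
   Otherwise the inner arcs that it cuts off are pancyclic, and two more are found at
   both ends of the chord: either the end arc or an inner arc of the adjacent chord. *)
Theorem hamiltonian_three_pancyclic_arcs n v (D : {pred T}) : 2 < n -> cyclic_seq e v n ->
  (forall i, v i \in D) -> three_pan e D v n.
Proof.
elim/ltn_ind: n v D => n IH v D n3 cv Dv.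
case: (eqVneq n 3) => [n_3|n_ne3].
  exists [:: 0; 1; 2]; split=> // i i3; split; first by rewrite !inE in i3; lia.
  move=> l ln; have -> : l = n by lia.
  exact: full_cycle.
pose P d := (1 < d) && has (fun i => e (v i) (v (i + d))) (iota 0 n).
have chordP d i : 1 < d -> e (v i) (v (i + d)) -> P d.
  move=> d1 ei; rewrite /P d1; apply/hasP; exists (i %% n).
    by rewrite mem_iota ltn_mod; lia.
  rewrite (cyc_mod cv) (cyc_eqmod cv (_ : i %% n + d = i + d %[mod n])) //.
  by rewrite modnDml.
(* Either [v 0 -> v 2] is a chord of length 2, or [v 2 -> v n] is one of length [n - 2]. *)
have [d' Pd' d'n] : exists2 d, P d & d <= n - 2.
  case: (boolP (e (v 0) (v 2))) => e02; first by exists 2; [apply: (chordP 2 0)|lia].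
  exists (n - 2) => //; apply: (chordP _ 2); first by lia.
  have -> : v (2 + (n - 2)) = v 0 by rewrite subnKC ?(cyc_vn cv) //; lia.
  apply: (narc tour) e02; apply/eqP => /(cyc_inj (a := 0) cv n3); lia.
case: (ex_minnP (ex_intro _ d' Pd')) => d /andP[d1 /hasP[i _ ei]] dmin.
have dn : d.+1 < n by have := dmin _ Pd'; lia.
have backv a L : 1 < L < d -> e (v (a + L)) (v a).
  move=> Ld; apply: (narc tour).
    apply/eqP => /(cyc_inj (a := a) cv n3); lia.
  by apply/negP => /(chordP L a ltac:(lia))/dmin; lia.
have main a : e (v a) (v (a + d)) ->
    three_pan e (outer (fun j => v (a + j)) n d) (shortcut (fun j => v (a + j)) n d) (n - d).+1.
  move=> ea; have cva := cyc_shift cv a.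
  have ea0 : e (v (a + 0)) (v (a + d)) by rewrite addn0.
  apply: IH; [lia | lia | exact: (shortcut_cyclic cva d1 dn ea0) | exact: (shortcut_outer cva d1 dn ea0)].
have back_a a b L : 1 < L < d -> e (v (a + (b + L))) (v (a + b)).
  by move=> Ld; rewrite addnA; apply: backv.
have shift a : three_pan e D (fun j => v (a + j)) n -> three_pan e D v n.
  exact: three_pan_shift.
have Dva a j : v (a + j) \in D by [].
have ch0 a : e (v a) (v (a + d)) -> e (v (a + 0)) (v (a + d)) by rewrite addn0.
case: (eqVneq d 2) => [d2|d_ne2].
  by apply: (shift i); apply: (three_pan_chord2 tour (cyc_shift cv i) (Dva i) d1 dn (ch0 i ei) d2 (main i ei)).
have d2 : 2 < d by lia.
have alt a : e (v a) (v (a + d)) -> three_pan e D v n \/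
    pan e (outer (fun j => v (a + j)) n d) (n - d).+1 (v (a + 0)) (v (a + d)).
  move=> ea; have := three_pan_back tour (cyc_shift cv a) (Dva a) d1 dn (ch0 a ea) d2 (back_a a) (main a ea).
  by case=> [/shift|]; [left|right].
have inner a j : e (v a) (v (a + d)) ->
   pan e (outer (fun j => v (a + j)) n d) (n - d).+1 (v (a + 0)) (v (a + d)) ->
   0 < j -> j.+1 < d -> pan e D n (v (a + j)) (v (a + j.+1)).
  move=> ea pg j0 jd; exact: (chord_inner (cyc_shift cv a) (Dva a) d1 dn (ch0 a ea) d2 (back_a a) pg j0 jd).
have [//|pi] := alt i ei.
have [//|[X [dX pX]]] : three_pan e D v n \/
    exists X, d.-1 <= X <= d /\ pan e D n (v (i + X)) (v (i + X.+1)).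
  case: (boolP (e (v (i + d.-1)) (v (i + d.-1 + d)))) => ch.
    have [|pg] := alt _ ch; [by left|right; exists d; split; first by lia].
    have := inner _ 1 ch pg isT d2.
    by have -> : i + d.-1 + 1 = i + d by [lia]; have -> : i + d.-1 + 2 = i + d.+1 by lia.
  right; exists d.-1; split; first by lia.
  have dd : d.-1.+1 = d by lia.
  rewrite dd; apply: (chord_last tour (cyc_shift cv i) (Dva i) d1 dn (ch0 i ei) d2 (back_a i) pi).
  by rewrite addnA.
(* The adjacent chord here ends at [v (i + n.+1)], that is at [v (i + 1)], and its last inner arc
   has index [n.-1]. *)
have [//|[Y [dY pY]]] : three_pan e D v n \/
    exists Y, (Y = 0 \/ Y = n.-1) /\ pan e D n (v (i + Y)) (v (i + Y.+1)).
  case: (boolP (e (v (i + (n.+1 - d))) (v (i + (n.+1 - d) + d)))) => ch.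
    have [|pg] := alt _ ch; [by left|right; exists n.-1; split; first by right].
    have := inner _ (d - 2) ch pg ltac:(lia) ltac:(lia).
    have -> : i + (n.+1 - d) + (d - 2) = i + n.-1 by lia.
    by have -> : i + (n.+1 - d) + (d - 2).+1 = i + n.-1.+1 by lia.
  right; exists 0; split; first by left.
  apply: (chord_first tour (cyc_shift cv i) (Dva i) d1 dn (ch0 i ei) d2 (back_a i) pi).
  by rewrite addnA.
apply: (shift i); exists [:: 1; X; Y]; split=> //.
  by rewrite /= !inE; case: dY => ->; lia.
move=> j; rewrite !inE => /or3P[] /eqP ->; split=> //; try lia.
exact: (inner i 1 ei pi).
Qed.

End MoonTheorem.

(** * Systems of distinct representatives *)

Section Hall.
Variables (I R : finType).

(** Induction on the size of [L]: a tight proper subset is matched by itself and its neighbours are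
    withdrawn from the rest; if there is none, any choice for one element leaves Hall's condition
    intact. The value [r0] only makes [f] total. *)
Theorem hall (r0 : R) (N : I -> {set R}) (L : {set I}) :
    (forall S : {set I}, S \subset L -> #|S| <= #|\bigcup_(i in S) N i|) ->
  exists f : I -> R, {in L, forall i, f i \in N i} /\ {in L &, injective f}.
Proof.
move: {2}#|L| (leqnn #|L|) => c; elim: c N L => [|c IH] N L Lc hallL.
  have L0 : L = set0 by apply/eqP; rewrite -cards_eq0 -leqn0.
  by exists (fun=> r0); split=> i; rewrite L0 inE.
have [->|[x xL]] := set_0Vmem L.
  by exists (fun=> r0); split=> i; rewrite inE.
case: (pickP [pred S : {set I} | [&& S \proper L, S != set0 & #|\bigcup_(i in S) N i| <= #|S|]]).
  move=> S /and3P[SL S0 tight]; have sSL := proper_sub SL.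
  have cS : #|S| < #|L| by apply: proper_card.
  have cLS : #|L :\: S| < #|L|.
    by rewrite cardsD (setIidPr sSL); move: S0; rewrite -card_gt0; lia.
  have [||f [fN fI]] := IH N S; first by lia.
    by move=> S' S'S; apply: hallL; apply: subset_trans S'S sSL.
  set NS := \bigcup_(i in S) N i in tight.
  have [|S' S'L|g [gN gI]] := IH (fun i => N i :\: NS) (L :\: S); first by lia.
    have disj : [disjoint S & S'].
      by rewrite disjoint_sym; apply: disjointWl S'L _; rewrite disjoints_subset setDE subsetIr.
    have := hallL (S :|: S'); rewrite subUset sSL (subset_trans S'L) ?subsetDl // => /(_ isT).
    rewrite cardsU (disjoint_setI0 disj) cards0 subn0 bigcup_setU -/NS => le.
    rewrite -(leq_add2l #|S|); apply: leq_trans le _.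
    have : NS :|: \bigcup_(i in S') N i \subset NS :|: \bigcup_(i in S') (N i :\: NS).
      rewrite subUset subsetUl /=; apply/bigcupsP => i iS'; apply/subsetP => y yN.
      rewrite inE; case: (boolP (y \in NS)) => //= yNS.
      by apply/bigcupP; exists i => //; rewrite inE yNS.
    move=> /subset_leq_card le; apply: leq_trans le _.
    by rewrite cardsU; apply: leq_trans (leq_subr _ _) _; rewrite leq_add2r.
  exists (fun i => if i \in S then f i else g i).
  have fNS i : i \in S -> f i \in NS by move=> iS; apply/bigcupP; exists i; rewrite ?fN.
  have gNS i : i \in L -> i \notin S -> g i \in N i :\: NS.
    by move=> iL iS; apply: gN; rewrite inE iS.
  split=> [i iL|i j iL jL].
    by case: ifPn => iS; [exact: fN | have := gNS i iL iS; rewrite inE => /andP[]].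
  case: ifPn => iS; case: ifPn => jS.
  - exact: fI.
  - by move=> E; have := gNS j jL jS; rewrite -E inE fNS.
  - by move=> E; have := gNS i iL iS; rewrite E inE fNS.
  - by apply: gI; rewrite inE ?iS ?jS.
move=> loose.
have [y yN] : exists y, y \in N x.
  have := hallL [set x]; rewrite sub1set xL cards1 big_set1 => /(_ isT).
  by case/card_gt0P => y; exists y.
have [||g [gN gI]] := IH (fun i => N i :\ y) (L :\ x).
- by rewrite (cardsD1 x L) xL in Lc.
- move=> S SL; have [->|S0] := eqVneq S set0; first by rewrite cards0.
  have sSL := subset_trans SL (subsetDl _ _).
  have pSL : S \proper L.
    rewrite properE sSL; apply/subsetPn; exists x => //.
    by apply/negP => /(subsetP SL); rewrite !inE eqxx.
  have := loose S; rewrite /= pSL S0 /= => /negbT; rewrite -ltnNge => lt.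
  rewrite -ltnS; apply: leq_trans lt _; rewrite (cardsD1 y); case: (y \in _) => /=.
    rewrite add1n ltnS; apply: subset_leq_card; apply/subsetP => z.
    rewrite !inE => /andP[zy /bigcupP[i iS zN]]; apply/bigcupP; exists i => //.
    by rewrite !inE zy.
  rewrite add0n ltnW // ltnS; apply: subset_leq_card; apply/subsetP => z.
  rewrite !inE => /andP[zy /bigcupP[i iS zN]]; apply/bigcupP; exists i => //.
  by rewrite !inE zy.
exists (fun i => if i == x then y else g i).
have gNy i : i \in L -> i != x -> g i \in N i :\ y by move=> iL ix; apply: gN; rewrite !inE ix.
split=> [i iL|i j iL jL].
  by case: eqVneq => [->//|ix]; have := gNy i iL ix; rewrite inE => /andP[].
case: eqVneq => [->|ix]; case: eqVneq => [->|jx] //.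
- by move=> E; have := gNy j jL jx; rewrite -E !inE eqxx.
- by move=> E; have := gNy i iL ix; rewrite E !inE eqxx.
- by apply: gI; rewrite !inE ?ix ?jx.
Qed.

Lemma leq_card_incidence (P : {set I}) (Q : {set R}) (r : I -> R -> bool) a b :
  0 < b -> b <= a -> (forall i, i \in P -> a <= #|[set j in Q | r i j]|) ->
  (forall j, j \in Q -> #|[set i in P | r i j]| <= b) -> #|P| <= #|Q|.
Proof.
move=> b0 ba deg1 deg2; rewrite -(leq_pmul2r b0).
apply: leq_trans (_ : \sum_(i in P) #|[set j in Q | r i j]| <= _).
  rewrite -sum_nat_const; apply: leq_sum => i iP; exact: leq_trans ba (deg1 i iP).
rewrite -[X in _ <= X]sum_nat_const.
have -> : \sum_(i in P) #|[set j in Q | r i j]| = \sum_(j in Q) #|[set i in P | r i j]|.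
  under eq_bigr do rewrite -sum1_card; under [RHS]eq_bigr do rewrite -sum1_card.
  rewrite (exchange_big_dep (mem Q)) /=; last by move=> i j _; rewrite inE => /andP[].
  apply: eq_bigr => j jQ; apply: eq_bigl => i; rewrite !inE jQ; by case: (i \in P).
exact: leq_sum.
Qed.

End Hall.

(* [lia] does not see through the [reverse_coercion] that elaboration leaves in
   the cardinals of sets of sets. *)
Ltac card_lia := intros; unfold reverse_coercion in *; lia.

(** * Counting the k-sets above a family of pairs *)

Section Supersets.
Variable V : finType.
Implicit Types (P Q T : {set V}) (S : {set {set V}}).

Lemma card_between P Q k : P \subset Q -> #|P| <= k ->
  #|[set T : {set V} | [&& P \subset T, T \subset Q & #|T| == k]]| = 'C(#|Q| - #|P|, k - #|P|).
Proof.
move=> PQ Pk; have -> : #|Q| - #|P| = #|Q :\: P| by rewrite cardsD (setIidPr PQ).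
rewrite -cards_draws.
have dis T : T \subset Q :\: P -> (T :|: P) :\: P = T.
  move=> TQ; rewrite setDUl setDv setU0; apply/setDidPl.
  by apply: disjointWl TQ _; rewrite disjoints_subset setDE subsetIr.
have inj : {in [set T : {set V} | [&& P \subset T, T \subset Q & #|T| == k]] &,
    injective (fun T => T :\: P)}.
  move=> T T'; rewrite !inE => /and3P[PT _ _] /and3P[PT' _ _] E.
  by rewrite -(setID T P) -(setID T' P) E (setIidPr PT) (setIidPr PT').
rewrite -(card_in_imset inj); apply: eq_card => T.
rewrite !inE; apply/imsetP/andP.
  case=> T'; rewrite inE => /and3P[PT' T'Q /eqP T'k] ->.
  by rewrite setSD // cardsD (setIidPr PT') T'k.
case=> TQ /eqP Tk; exists (T :|: P); last by rewrite dis.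
rewrite inE subsetUr subUset PQ (subset_trans TQ) ?subsetDl //=.
have := cardsU T P; have -> : T :&: P = set0.
  by apply: disjoint_setI0; apply: disjointWl TQ _; rewrite disjoints_subset setDE subsetIr.
by rewrite cards0 Tk; lia.
Qed.

Definition supersets k P : {set {set V}} := [set Q : {set V} | (P \subset Q) && (#|Q| == k)].

Lemma card_supersets k P : #|P| <= k -> #|supersets k P| = 'C(#|V| - #|P|, k - #|P|).
Proof.
move=> Pk; rewrite -[#|V|]cardsT -card_between ?subsetT //.
by apply: eq_card => Q; rewrite !inE subsetT.
Qed.

Lemma supersets_le1 k P : k <= #|P| -> #|supersets k P| <= 1.
Proof.
move=> kP; rewrite -(cards1 P); apply: subset_leq_card; apply/subsetP => Q.
rewrite !inE => /andP[PQ /eqP Qk]; rewrite eq_sym eqEcard PQ Qk; exact: kP.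
Qed.

Lemma card_setU_neq P1 P2 : #|P1| = 2 -> #|P2| = 2 -> P1 != P2 -> 3 <= #|P1 :|: P2|.
Proof.
move=> c1 c2; apply: contraNltn => lt.
have E1 : P1 = P1 :|: P2 by apply/eqP; rewrite eqEcard subsetUl c1.
have E2 : P2 = P1 :|: P2 by apply/eqP; rewrite eqEcard subsetUr c2.
by rewrite E1 [X in _ == X]E2.
Qed.

Definition upper k (S : {set {set V}}) : {set {set V}} := \bigcup_(P in S) supersets k P.

Lemma upperP k S Q : reflect (#|Q| = k /\ exists2 P, P \in S & P \subset Q) (Q \in upper k S).
Proof.
apply: (iffP bigcupP) => [[P PS]|[Qk [P PS PQ]]].
  by rewrite inE => /andP[PQ /eqP Qk]; split=> //; exists P.
by exists P; rewrite // inE PQ Qk eqxx.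
Qed.

Hypothesis n7 : 7 <= #|V|.

(** Double counting of inclusions: ['C(k, 3) = 'C(k, k - 3)] is at most ['C(#|V| - 3, k - 3)] since
    [k <= #|V| - 3]. *)
Lemma leq_upper3 k S : 3 <= k <= #|V| - 3 -> #|upper 3 S| <= #|upper k S|.
Proof.
move=> kn; apply: (@leq_card_incidence _ _ _ _ (fun T Q => T \subset Q)
    'C(#|V| - 3, k - 3) 'C(k, 3)).
- by rewrite bin_gt0; lia.
- by rewrite -[X in X <= _]bin_sub; [apply: leq_bin2l; lia|lia].
- move=> T /upperP[T3 [P PS PT]]; rewrite -{1}T3 -[in k - 3]T3 -card_supersets ?T3; last by lia.
  apply: subset_leq_card; apply/subsetP => Q; rewrite !inE => /andP[TQ /eqP Qk].
  rewrite TQ andbT; apply/upperP; split=> //; exists P => //; exact: subset_trans PT TQ.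
- move=> Q /upperP[Qk _]; rewrite -Qk -cards_draws; apply: subset_leq_card.
  by apply/subsetP => T; rewrite !inE => /andP[/upperP[-> _] ->].
Qed.

(* Two pairs are contained in at least [2n - 5 >= n + 2] triples; each of the remaining
   pairs is contained in at least three triples avoiding both, and a triple contains
   only three pairs. *)
Lemma leq_upper3_pairs S : (forall P, P \in S -> #|P| = 2) -> 2 <= #|S| ->
  #|S| + #|V| <= #|upper 3 S|.
Proof.
move=> S2 cS; have [P1 P1S] : exists P1, P1 \in S by apply/card_gt0P; exact: leq_trans cS.
have [P2] : exists P2, P2 \in S :\ P1.
  have : 0 < #|S :\ P1| by move: cS; rewrite (cardsD1 P1 S) P1S add1n ltnS.
  exact/card_gt0P.
rewrite !inE => /andP[P21 P2S].
have sup3 P : P \in S -> #|supersets 3 P| = #|V| - 2.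
  by move=> PS; rewrite card_supersets S2 // bin1.
have inter P P' : P \in S -> P' \in S -> P != P' -> #|supersets 3 P :&: supersets 3 P'| <= 1.
  move=> PS P'S PP'; apply: leq_trans (supersets_le1 (card_setU_neq (S2 _ PS) (S2 _ P'S) PP')).
  apply: subset_leq_card; apply/subsetP => Q; rewrite !inE subUset.
  by case/andP=> /andP[-> ->] /andP[-> _].
set A := supersets 3 P1 :|: supersets 3 P2.
have cA : 2 * #|V| <= #|A| + 5.
  by rewrite cardsU !sup3 //; have := inter P1 P2 P1S P2S; rewrite eq_sym P21 => /(_ isT); lia.
have AU : A \subset upper 3 S by rewrite subUset !bigcup_sup.
have : #|S :\ P1 :\ P2| <= #|upper 3 S :\: A|.
  apply: (@leq_card_incidence _ _ _ _ (fun T Q => T \subset Q) 3 3) => // [P|Q].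
    rewrite !inE => /and3P[PP2 PP1 PS].
    have sub : supersets 3 P :\: (supersets 3 P :&: supersets 3 P1 :|: supersets 3 P :&: supersets 3 P2)
       \subset [set Q in upper 3 S :\: A | P \subset Q].
      apply/subsetP => Q; rewrite !inE => /andP[nQ /andP[PQ Q3]].
      move: nQ; rewrite PQ Q3 /= !andbT => ->; rewrite /=.
      by apply/upperP; split; [exact/eqP | exists P].
    apply: leq_trans (subset_leq_card sub); rewrite cardsD.
    have := subset_leq_card (subsetIr (supersets 3 P) (supersets 3 P :&: supersets 3 P1 :|: supersets 3 P :&: supersets 3 P2)).
    have := (leq_card_setU (supersets 3 P :&: supersets 3 P1) (supersets 3 P :&: supersets 3 P2)).1.
    have := inter P P1 PS P1S PP1; have := inter P P2 PS P2S PP2; rewrite sup3 //.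
    lia.
  rewrite inE => /andP[_ /upperP[Q3 _]].
  have -> : 3 = 'C(#|Q|, 2) by rewrite Q3.
  rewrite -cards_draws; apply: subset_leq_card; apply/subsetP => P.
  by rewrite !inE => /andP[/and3P[_ _ /S2 ->] ->].
have := cardsD (upper 3 S) A; rewrite (setIidPr AU).
have := subset_leq_card AU.
have := cardsD1 P1 S; have := cardsD1 P2 (S :\ P1); rewrite P1S !inE P21 P2S !add1n.
card_lia.
Qed.

(** The double counting of [leq_upper3], now above a fixed pair and from 4-sets:
    ['C(k - 2, 2) = 'C(k - 2, k - 4)] is at most ['C(#|V| - 4, k - 4)]. *)
Lemma leq_card_supersets4 k P : #|P| = 2 -> 4 <= k -> k + 2 <= #|V| ->
  'C(#|V| - 2, 2) <= #|supersets k P|.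
Proof.
move=> P2 k4 kn; rewrite -[X in 'C(_ - X, _)]P2 -[X in 'C(_, X)]/(4 - 2) -[X in 4 - X]P2.
rewrite -card_supersets ?P2 //.
apply: (@leq_card_incidence _ _ _ _ (fun T Q => T \subset Q) 'C(#|V| - 4, k - 4) 'C(k - 2, 2)).
- by rewrite bin_gt0; lia.
- rewrite -[X in X <= _]bin_sub; last by lia.
  have -> : k - 2 - 2 = k - 4 by lia.
  by apply: leq_bin2l; lia.
- move=> T; rewrite inE => /andP[PT /eqP T4].
  rewrite -{1}T4 -[in k - 4]T4 -card_supersets ?T4 //.
  apply: subset_leq_card; apply/subsetP => Q; rewrite !inE => /andP[TQ ->].
  by rewrite TQ (subset_trans PT TQ).
- move=> Q; rewrite inE => /andP[PQ /eqP Qk].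
  have -> : 'C(k - 2, 2) = 'C(#|Q| - #|P|, 4 - #|P|) by rewrite Qk P2.
  rewrite -card_between ?P2 //; apply: subset_leq_card; apply/subsetP => T.
  by rewrite !inE => /andP[/andP[-> ->] ->].
Qed.

(** Two pairs or more have [#|V|] k-sets beyond their own number, which makes up for all of [U]. A
    single pair has more than [#|V|] supersets if [k >= 4], but only [#|V| - 2 >= 5] if [k = 3]; the
    last hypothesis then leaves one outside [U]. *)
Lemma exists_pair_assignment k (U L : {set {set V}}) : 3 <= k <= #|V| - 3 ->
    #|U| <= #|V| -> (forall P, P \in L -> #|P| = 2) ->
    (k = 3 -> forall P, P \in L -> #|[set Q in U | P \subset Q]| <= 4) ->
  exists f : {set V} -> {set V}, {in L &, injective f} /\
    {in L, forall P, [/\ P \subset f P, #|f P| = k & f P \notin U]}.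
Proof.
move=> kn Un L2 U3; pose N P := supersets k P :\: U.
have [S SL|f [fN fI]] := @hall _ _ set0 N L; last first.
  exists f; split=> // P /fN; rewrite !inE => /andP[-> /andP[-> /eqP ->]].
  by split.
have -> : \bigcup_(P in S) N P = upper k S :\: U.
  apply/setP => Q; rewrite inE; apply/bigcupP/andP => [[P PS]|[QU /bigcupP[P PS Q_]]].
    by rewrite inE => /andP[QU Q_]; split=> //; apply/bigcupP; exists P.
  by exists P; rewrite // inE QU.
have S2 P : P \in S -> #|P| = 2 by move/(subsetP SL)/L2.
case: (ltnP 1 #|S|) => cS.
  have := leq_upper3_pairs S2 cS; have := leq_upper3 S kn; rewrite cardsD.
  have := subset_leq_card (subsetIr (upper k S) U); card_lia.
have [->|[P PS]] := set_0Vmem S; first by rewrite cards0.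
have PL := subsetP SL P PS; have {}S2 := S2 P PS.
have {SL cS PS} -> : S = [set P].
  by apply/esym/eqP; rewrite eqEcard sub1set PS cards1.
rewrite cards1 /upper big_set1 cardsD.
case: (eqVneq k 3) => [k3|k_3].
  have := U3 k3 P PL; have -> : #|supersets k P| = #|V| - 2.
    by rewrite k3 card_supersets S2 // bin1.
  have : #|supersets k P :&: U| <= #|[set Q in U | P \subset Q]|.
    apply: subset_leq_card; apply/subsetP => Q.
    by rewrite !inE => /andP[/andP[-> _] ->].
  card_lia.
have := @leq_card_supersets4 k P S2; rewrite bin2 => le.
have := subset_leq_card (subsetIr (supersets k P) U).
have {le} : #|V| < #|supersets k P|.
  apply: leq_trans (le _ _); [|lia|lia].
  rewrite -divn2 leq_divRL //; nia.
card_lia.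
Qed.

End Supersets.

(** * From a Hamiltonian cycle to a tournament *)

Section Hypertournament.
Variables (V : finType) (k : nat) (A : {set k.-tuple V}).
Hypothesis HA : is_ktournament A.

Definition vset (t : k.-tuple V) : {set V} := [set x in t].

Lemma card_vset t : t \in A -> #|vset t| = k.
Proof.
by case: HA => uA _ /uA ut; rewrite cardsE (card_uniqP ut) size_tuple.
Qed.

Lemma vset_inj : {in A &, injective vset}.
Proof.
move=> t t' tA t'A E; case: HA => _ /(_ (vset t) (card_vset tA)) /eqP /cards1P[u Eu].
have : t \in [set u] by rewrite -Eu inE tA /vset eqxx.
have : t' \in [set u] by rewrite -Eu inE t'A -/(vset t') -E eqxx.
by rewrite !inE => /eqP -> /eqP ->.
Qed.

Lemma arc_exists (S : {set V}) : #|S| = k -> exists2 t, t \in A & vset t = S.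
Proof.
move=> /(proj2 HA) /eqP /cards1P[t E].
have : t \in [set t] by rewrite inE.
by rewrite -E inE => /andP[tA /eqP]; exists t.
Qed.

Lemma precedes_total t x y : t \in A -> x \in t -> y \in t -> x != y ->
  precedes t x y = ~~ precedes t y x.
Proof.
move=> _ xt yt xy; rewrite /precedes xt yt /=; case: ltngtP => // E.
by move: xy; rewrite -(nth_index x xt) E nth_index // eqxx.
Qed.

Lemma precedes_mem (t : k.-tuple V) x y : precedes t x y -> [/\ x \in t, y \in t & x != y].
Proof.
case/and3P=> xt yt lt; split=> //; by apply: contraTneq lt => ->; rewrite ltnn.
Qed.

(** * Tournaments given by one hyperarc for every pair *)

Section PairTournament.
Variable phi : {set V} -> k.-tuple V.
Hypothesis phiA : forall x y, x != y -> [/\ phi [set x; y] \in A, x \in phi [set x; y] & y \in phi [set x; y]].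
Hypothesis phi_inj : forall x y z w, x != y -> z != w ->
  phi [set x; y] = phi [set z; w] -> [set x; y] = [set z; w].

(* Each pair of vertices is oriented by a hyperarc of its own, hence cycles of this
   tournament are cycles of the hypertournament. *)
Definition pair_rel : rel V := fun x y => (x != y) && precedes (phi [set x; y]) x y.

Lemma pair_tournament : tournament pair_rel.
Proof.
split=> [x|x y xy]; first by rewrite /pair_rel eqxx.
have [pA px py] := phiA xy; rewrite /pair_rel xy eq_sym xy /= setUC.
by apply: precedes_total; rewrite // setUC.
Qed.

Lemma lift_cycle l (s : seq V) : cycle pair_rel s -> uniq s -> size s = l -> 0 < l ->
  exists (x : 'I_l -> V) (a : 'I_l -> k.-tuple V), is_cycle A x a /\
    (forall u, u \in s -> exists i, x i = u /\ a i = phi [set u; next s u]).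
Proof.
move=> cs us sl l0; have [x0 x0s] : exists x0, x0 \in s.
  by case: s sl {cs us} l0 => [/= <- //|x0 s _ _]; exists x0; rewrite mem_head.
pose x (i : 'I_l) := nth x0 s i; pose a i := phi [set x i; next s (x i)].
have xs i : x i \in s by rewrite mem_nth // sl.
have en i : pair_rel (x i) (next s (x i)) by apply: next_cycle.
have nx i : next s (x i) = x (ordS i).
  rewrite next_nth xs index_uniq ?sl // /x /=; case: s sl us {cs x0s a xs en} @x => [|z s] sl us x.
    by rewrite -sl in l0.
  rewrite /= in sl; case: (ltnP i.+1 l) => il.
    by rewrite modn_small //=; apply: set_nth_default; lia.
  have -> : i.+1 = l by apply/eqP; rewrite eqn_leq il ltn_ord.
  by rewrite modnn /= nth_default //; have := ltn_ord i; lia.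
exists x, a; split; last first.
  move=> u us'; have li : index u s < l by rewrite -sl index_mem.
  by exists (Ordinal li); rewrite /a /x /= nth_index.
have xinj : injective x.
  by move=> i j /eqP; rewrite nth_uniq ?sl // => /eqP /val_inj.
have ne i : x i != next s (x i) by case/andP: (en i).
split=> //; split; last split.
(* Equal pairs belong to equal or opposite arcs, and asymmetry excludes the latter. *)
- move=> i j /(phi_inj (ne i) (ne j)) E; apply: xinj.
  have := setU11 (x i) [set next s (x i)]; rewrite E !inE => /orP[/eqP//|/eqP xi].
  have : next s (x i) \in [set x j; next s (x j)] by rewrite -E !inE eqxx orbT.
  rewrite !inE -xi => /orP[/eqP xj|]; last by rewrite eq_sym (negPf (ne i)).
  by have := en j; rewrite -xi -xj (arc_asym pair_tournament (en i)).
- by move=> i; case: (phiA (ne i)).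
- by move=> i; have /andP[_] := en i; rewrite -nx.
Qed.

End PairTournament.

(** * Extension of a Hamiltonian cycle to such a tournament *)

Section Hamiltonian.
Variable n : nat.
Hypotheses (Vn : #|V| = n) (n7 : 7 <= n) (k3 : 3 <= k) (kn : k <= n - 3).
Variables (x : 'I_n -> V) (a : 'I_n -> k.-tuple V).
Hypothesis Hc : is_cycle A x a.

Let xI : injective x. Proof. by case: Hc. Qed.
Let aI : injective a. Proof. by case: Hc => _ []. Qed.
Let aA i : a i \in A. Proof. by case: Hc => _ [_ []]. Qed.
Let aP i : precedes (a i) (x i) (x (ordS i)). Proof. by case: Hc => _ [_ []]. Qed.

Definition edge i : {set V} := [set x i; x (ordS i)].

Lemma edge_neq i : x i != x (ordS i).
Proof. by case: (precedes_mem (aP i)). Qed.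

Lemma edge_inj : injective edge.
Proof.
move=> i j E; apply: xI.
have := setU11 (x i) [set x (ordS i)]; rewrite -/(edge i) E !inE => /orP[/eqP//|/eqP/xI ij].
have : x (ordS i) \in edge j by rewrite -E !inE eqxx orbT.
rewrite !inE => /orP[/eqP/xI ji|/eqP/xI/(bij_inj (ordS_bij _)) ->//].
have := congr1 val ji; rewrite ij /= => /eqP.
rewrite -addn1 modnDml addn1 => E2.
have : j.+2 = j %[mod n] by rewrite [RHS]modn_small ?ltn_ord //; apply/eqP.
move/eqP; rewrite -[j.+2]addn2 -[X in _ == X %[mod _]]addn0 eqn_modDl !modn_small; lia.
Qed.

Lemma edge_arc i : edge i \subset vset (a i).
Proof.
have [xa ya _] := precedes_mem (aP i).
by apply/subsetP => y; rewrite !inE => /orP[] /eqP ->.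
Qed.

Lemma exists_extension : exists phi : {set V} -> k.-tuple V,
  [/\ forall u v, u != v -> [/\ phi [set u; v] \in A, u \in phi [set u; v] & v \in phi [set u; v]],
      forall u v z w, u != v -> z != w -> phi [set u; v] = phi [set z; w] -> [set u; v] = [set z; w]
    & forall i, phi (edge i) = a i].
Proof.
pose U : {set {set V}} := [set vset (a i) | i : 'I_n].
pose L : {set {set V}} := [set P : {set V} | (#|P| == 2) && (P \notin [set edge i | i : 'I_n])].
have [|||||g [gI gP]] := @exists_pair_assignment V _ k U L.
- by rewrite Vn.
- by rewrite Vn; lia.
- by rewrite Vn; apply: leq_trans (leq_imset_card _ _) _; rewrite card_ord.
- by move=> P; rewrite inE => /andP[/eqP].
(* Three vertices cannot contain both [P] and a disjoint edge. So [P] contains an end of [edge i],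
   which allows two indices for each end. *)
- move=> k_3 P; rewrite inE => /andP[/eqP P2 /imsetP Pe].
  pose I1 := [set i | x i \in P]; pose I2 := [set i | x (ordS i) \in P].
  have cI (h : 'I_n -> V) : injective h -> #|[set i | h i \in P]| <= 2.
    move=> hI; rewrite -P2 -(card_imset _ hI); apply: subset_leq_card.
    by apply/subsetP => y /imsetP[i]; rewrite inE => ? ->.
  have c1 : #|I1| <= 2 by exact: cI.
  have c2 : #|I2| <= 2 by apply: (cI (fun i => x (ordS i))) => i j /xI /(bij_inj (ordS_bij _)).
  have sub : [set Q in U | P \subset Q] \subset [set vset (a i) | i in I1 :|: I2].
    apply/subsetP => Q; rewrite inE => /andP[/imsetP[i _ ->] PQ].
    apply/imset_f; rewrite !inE; apply: contraT => /norP[n1 n2].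
    have dis : P :&: edge i = set0.
      apply/setP => y; rewrite !inE; apply/andP => -[yP /orP[] /eqP E].
        by rewrite -E yP in n1.
      by rewrite -E yP in n2.
    have : P :|: edge i \subset vset (a i) by rewrite subUset PQ edge_arc.
    move/subset_leq_card; rewrite cardsU dis cards0 P2 cards2 edge_neq card_vset //; lia.
  apply: leq_trans (subset_leq_card sub) _; apply: leq_trans (leq_imset_card _ _) _.
  by apply: leq_trans (leq_card_setU _ _).1 _; lia.
have i0 : 'I_n by exact: (Ordinal (leq_trans (isT : 0 < 7) n7)).
pose f (S : {set V}) := odflt (a i0) [pick t in A | vset t == S].
have fP (S : {set V}) : #|S| = k -> f S \in A /\ vset (f S) = S.
  move=> /arc_exists[t tA tS]; rewrite /f; case: pickP => [u /andP[uA /eqP]//|/(_ t)].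
  by rewrite tA tS eqxx.
pose phi (P : {set V}) := if [pick i | edge i == P] is Some i then a i else f (g P).
have phie i : phi (edge i) = a i.
  by rewrite /phi; case: pickP => [j /eqP/edge_inj -> //|/(_ i)]; rewrite eqxx.
have phiN (P : {set V}) : #|P| = 2 -> (exists i, P = edge i) \/ P \in L /\ phi P = f (g P).
  move=> P2; rewrite /phi; case: pickP => [i /eqP <-|no]; first by left; exists i.
  right; split=> //; rewrite inE P2 eqxx; apply/imsetP => -[i _ E].
  by have := no i; rewrite E eqxx.
have c2 (u v : V) : u != v -> #|[set u; v]| = 2 by move=> uv; rewrite cards2 uv.
have main (P : {set V}) : #|P| = 2 -> phi P \in A /\ P \subset vset (phi P).
  move=> /phiN[[i ->]|[PL ->]]; first by rewrite phie edge_arc aA.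
  have [sub c _] := gP P PL; have [-> ->] := fP _ c; by rewrite sub.
exists phi; split=> // [u v uv|u v z w uv zw].
  have [pA /subsetP sub] := main _ (c2 u v uv); split=> //.
    by have := sub u; rewrite !inE eqxx /= => ->.
  by have := sub v; rewrite !inE eqxx orbT => ->.
have cross i P : P \in L -> a i = f (g P) -> False.
  move=> PL E; have [_ c] := gP P PL; case/imsetP; exists i => //.
  by rewrite E; case: (fP _ c).
case: (phiN _ (c2 u v uv)) => [[i ->]|[L1 E1]]; case: (phiN _ (c2 z w zw)) => [[j ->]|[L2 E2]].
- by rewrite !phie => /aI ->.
- by rewrite phie E2 => /(cross i _ L2).
- by rewrite phie E1 => /esym /(cross j _ L1).
- rewrite E1 E2 => E; apply: gI => //.
  have [_ k1 _] := gP _ L1; have [_ k2 _] := gP _ L2.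
  by rewrite -(proj2 (fP _ k1)) E (proj2 (fP _ k2)).
Qed.

Theorem hamiltonian_pancyclic : vertex_pancyclic A /\
  exists i j l : 'I_n, [/\ i != j, i != l, j != l &
         [/\ pancyclic_arc A (a i), pancyclic_arc A (a j) & pancyclic_arc A (a l)]].
Proof.
have [phi [phiA phi_inj phie]] := exists_extension.
set e := pair_rel phi; have te : tournament e := pair_tournament phiA.
have n0 : 0 < n by lia.
pose v j := x (Ordinal (ltn_pmod j n0)).
have ve j : edge (Ordinal (ltn_pmod j n0)) = [set v j; v j.+1].
  rewrite /edge /v; congr [set _; x _]; apply: val_inj => /=.
  by rewrite -addn1 modnDml addn1.
have cv : cyclic_seq e v n.
  split=> [i|i|i j /xI].
  - have := aP (Ordinal (ltn_pmod i n0)); have := edge_neq (Ordinal (ltn_pmod i n0)).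
    have E := ve i; have vS : x (ordS (Ordinal (ltn_pmod i n0))) = v i.+1.
      by rewrite /v; congr x; apply: val_inj => /=; rewrite -addn1 modnDml addn1.
    by rewrite vS -phie E /e /pair_rel => -> ->.
  - by rewrite /v; congr x; apply: val_inj => /=; rewrite modnDr.
  - by move/(congr1 val).
have vx (i : 'I_n) : v i = x i by rewrite /v; congr x; apply: val_inj => /=; rewrite modn_small.
have surj y : exists j, v j = y.
  have [z _ zx] : bijective x by apply: inj_card_bij; rewrite // card_ord Vn.
  by exists (z y); rewrite vx zx.
split.
  have str : strong_rel e.
    move=> P [y1 Py1] [y2 Py2]; have [j1 E1] := surj y1; have [j2 E2] := surj y2.
    (* Follow the cycle from index [j1]: since [j2 + n * j1] is congruent to [j2] and not below
       [j1], the set [P] is left on the way. *)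
    case: (boolP (has (fun j => P (v j) && ~~ P (v j.+1)) (iota j1 (j2 + n * j1)))) => [/hasP[j _ /andP[p1 p2]]|/hasPn no].
      by exists (v j), (v j.+1); split=> //; exact: cyc_next cv j.
    have all_ m : m <= j2 + n * j1 -> P (v (j1 + m)).
      elim: m => [|m IH] mm; first by rewrite addn0 E1.
      have := no (j1 + m); rewrite mem_iota IH; last by lia.
      by rewrite addnS /= => /(_ ltac:(lia)); rewrite negbK.
    have := all_ (j2 + n * j1 - j1); have -> : j1 + (j2 + n * j1 - j1) = j2 + n * j1 by nia.
    have -> : v (j2 + n * j1) = v j2 by apply: (cyc_eqmod cv); rewrite addnC mulnC modnMDl.
    by rewrite E2 (negPf Py2) => /(_ (leq_subr _ _)).
  move=> y l /andP[l3 lV].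
  have [|s [cs us ys sl]] := @strong_vertex_pancyclic _ _ te str y l; first by rewrite l3.
  have [|x' [a' [c' mem']]] := lift_cycle phiA phi_inj cs us sl; first by lia.
  by exists x', a'; split=> //; have [i [xi _]] := mem' y ys; exists i.
have [s [s3 us pans]] := @hamiltonian_three_pancyclic_arcs _ e te n v predT ltac:(lia) cv (fun=> isT).
have pa (i : 'I_n) : pan e predT n (v i) (v i.+1) -> pancyclic_arc A (a i).
  move=> p l ln; rewrite Vn in ln; have [q [cq uq _ sq]] := p l ln.
  have [||x' [a' [c' mem']]] := @lift_cycle phi phiA phi_inj l _ cq uq; [by rewrite -sq /= addn2 | by lia |].
  exists x', a'; split=> //; have [j [_ aj]] := mem' (v i) (mem_head _ _); exists j.
  rewrite aj /= eqxx -phie; congr phi; rewrite -ve; congr edge.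
  by apply: val_inj; rewrite /= modn_small.
case: s s3 us pans => [|i1 [|i2 [|i3 s]]] // _ us pans.
have [l1 p1] := pans i1 (mem_head _ _).
have [l2 p2] := pans i2 ltac:(by rewrite !inE eqxx orbT).
have [l3 p3] := pans i3 ltac:(by rewrite !inE eqxx !orbT).
exists (Ordinal l1), (Ordinal l2), (Ordinal l3).
move: us; rewrite /= !inE !negb_or => /and3P[/and3P[i12 i13 _] /andP[i23 _] _].
by split=> //; split; apply: pa.
Qed.

End Hamiltonian.
End Hypertournament.

(** * Existence of a Hamiltonian cycle *)

Section Majority.
Variables (V : finType) (k : nat) (A : {set k.-tuple V}).
Hypothesis HA : is_ktournament A.

Definition arcs_on (P : {set V}) : {set k.-tuple V} := [set t in A | P \subset vset t].

Lemma card_arcs_on P : #|arcs_on P| = #|supersets k P|.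
Proof.
rewrite -(card_in_imset (f := @vset V k)); last first.
  move=> t t'; rewrite !inE => /andP[tA _] /andP[t'A _]; exact: (vset_inj HA).
apply: eq_card => Q; rewrite inE; apply/imsetP/andP => [[t]|[PQ /eqP Qk]].
  by rewrite inE => /andP[tA Pt] ->; rewrite Pt (card_vset HA tA).
by have [t tA tQ] := arc_exists HA Qk; exists t; rewrite // inE tA tQ.
Qed.

Definition arcs_from (x y : V) : {set k.-tuple V} := [set t in A | precedes t x y].

Lemma arcs_from_sub x y : arcs_from x y \subset arcs_on [set x; y].
Proof.
apply/subsetP => t; rewrite !inE => /andP[-> /precedes_mem[xt yt _]] /=.
by apply/subsetP => z; rewrite !inE => /orP[] /eqP ->.
Qed.

Lemma card_arcs_from x y : x != y -> 2 <= k ->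
  #|arcs_from x y| + #|arcs_from y x| = 'C(#|V| - 2, k - 2).
Proof.
move=> xy k2; have c2 : #|[set x; y]| = 2 by rewrite cards2 xy.
rewrite -[X in 'C(_ - X, _)]c2 -[X in k - X]c2 -card_supersets ?c2 //.
rewrite -card_arcs_on -cardsUI.
have -> : arcs_from x y :&: arcs_from y x = set0.
  apply/setP => t; rewrite !inE; apply/negP => /andP[/andP[tA p1] /andP[_ p2]].
  have [xt yt _] := precedes_mem p1; move: p1.
  by rewrite (precedes_total tA) // p2.
rewrite cards0 addn0; apply: eq_card => t; rewrite in_setU; apply/orP/idP.
  case; first exact: (subsetP (arcs_from_sub x y)).
  by rewrite setUC; apply: (subsetP (arcs_from_sub y x)).
rewrite !inE => /andP[tA /subsetP sub].
have xt : x \in t by have := sub x; rewrite !inE eqxx => /(_ isT).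
have yt : y \in t by have := sub y; rewrite !inE eqxx orbT => /(_ isT).
rewrite tA /= (precedes_total tA xt yt xy).
by case: (precedes t y x); [right|left].
Qed.

Lemma precedes_trans (t : k.-tuple V) x y z : precedes t x y -> precedes t y z -> precedes t x z.
Proof.
rewrite /precedes => /and3P[-> yt xy] /and3P[_ -> yz]; exact: ltn_trans xy yz.
Qed.

Definition has_hamiltonian_cycle (n : nat) : Prop :=
  exists (x : 'I_n -> V) (a : 'I_n -> k.-tuple V), is_cycle A x a.

Lemma cycle_of_seqs n (s : seq V) (b : seq (k.-tuple V)) : 0 < n ->
    size s = n -> size b = n -> uniq s -> uniq b ->
    (forall x0 b0 i, i < n -> nth b0 b i \in A /\ precedes (nth b0 b i) (nth x0 s i) (nth x0 s (i.+1 %% n))) ->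
  has_hamiltonian_cycle n.
Proof.
case: s => [|x0 s]; first by move=> n0 /= E; rewrite -E in n0.
case: b => [|b0 b]; first by move=> n0 _ /= E; rewrite -E in n0.
move=> n0 ss sb us ub H.
exists (fun i => nth x0 (x0 :: s) i), (fun i => nth b0 (b0 :: b) i).
split=> [i j /eqP|]; last split=> [i j /eqP|]; last split=> i.
- by rewrite nth_uniq ?ss // => /eqP /val_inj.
- by rewrite nth_uniq ?sb // => /eqP /val_inj.
- by have [] := H x0 b0 i (ltn_ord i).
- by have [] := H x0 b0 i (ltn_ord i).
Qed.

(* [c] lists the vertices in cyclic order; the steps [i < q] are already represented by
   the hyperarcs [b i], and the other steps go along the majority of the hyperarcs. *)
Section Completion.
Variables (n q : nat) (c : nat -> V) (b : nat -> k.-tuple V).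
Hypotheses (Vn : #|V| = n) (n7 : 7 <= n) (k3 : 3 <= k) (kn : k <= n - 3).
Hypotheses (cI : forall i j, i < n -> j < n -> c i = c j -> i = j).
Hypotheses (q0 : 0 < q) (qn : q < n).
Hypotheses (bI : forall i j, i < q -> j < q -> b i = b j -> i = j).
Hypotheses (bA : forall i, i < q -> b i \in A).
Hypotheses (bP : forall i, i < q -> precedes (b i) (c i) (c i.+1)).

Definition nx i := i.+1 %% n.
Definition Warc i := arcs_from (c i) (c (nx i)).

Hypotheses (maj : forall i, q <= i < n -> 'C(n - 2, k - 2) <= 2 * #|Warc i|).
(** The given steps come from a path that no single hyperarc can shorten. Hence all hyperarcs on
    [c 0] and [c q] put [c q] first, which closes the cycle in the tightest cases. *)
Hypotheses (norev : 1 < q -> arcs_from (c 0) (c q) = set0).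

Lemma nx_lt i : nx i < n. Proof. by rewrite ltn_mod; lia. Qed.
Lemma nxE i : i < n -> nx i = if i.+1 == n then 0 else i.+1.
Proof. by move=> ilt; rewrite /nx; case: eqP => [->|ne]; rewrite ?modnn // modn_small; lia. Qed.

Lemma nxP i : i < n -> i.+1 = n /\ nx i = 0 \/ i.+1 < n /\ nx i = i.+1.
Proof. by move=> ilt; rewrite nxE //; case: eqP => ?; [left | right; split=> //; lia]. Qed.

Definition cedge i : {set V} := [set c i; c (nx i)].

Lemma c_eq i j : i < n -> j < n -> (c i == c j) = (i == j).
Proof. by move=> ilt jlt; apply/eqP/eqP => [/(cI ilt jlt)|->]. Qed.

Lemma card_cedge i : i < n -> #|cedge i| = 2.
Proof.
by move=> ilt; rewrite cards2 c_eq ?nx_lt //; have := nxP ilt; lia.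
Qed.

Lemma cedge_disjoint i j : i < n -> j < n -> i != j -> i != nx j -> j != nx i ->
  #|cedge i :|: cedge j| = 4.
Proof.
move=> il jl ij ij1 ji1; rewrite cardsU !card_cedge // (_ : _ :&: _ = set0) ?cards0 //.
apply/setP => z; rewrite !inE; apply/negP.
case/andP=> /orP[] /eqP ->; rewrite !c_eq ?nx_lt // ?(negPf ij) ?(negPf ij1) //=.
  by have := nxP il; have := nxP jl; lia.
Qed.

Lemma cedge_neq i j : i < n -> j < n -> i != j -> cedge i != cedge j.
Proof.
move=> il jl ij; apply/eqP => E.
have := setU11 (c i) [set c (nx i)]; rewrite -/(cedge i) E !inE !c_eq ?nx_lt // (negPf ij) /= => /eqP E1.
have : c (nx i) \in cedge j by rewrite -E !inE eqxx orbT.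
rewrite !inE !c_eq ?nx_lt // => E2.
by have := nxP il; have := nxP jl; lia.
Qed.

Lemma Warc_cedge i t : t \in Warc i -> cedge i \subset vset t.
Proof. by move/(subsetP (arcs_from_sub _ _)); rewrite inE => /andP[]. Qed.

Lemma WarcA i t : t \in Warc i -> t \in A.
Proof. by rewrite inE => /andP[]. Qed.

Lemma b_cedge i : i < q -> cedge i \subset vset (b i).
Proof.
move=> iq; apply: Warc_cedge; rewrite inE bA //= nxE; last by lia.
case: eqP => [E|_]; [lia|exact: bP].
Qed.

Definition used : {set k.-tuple V} := [set b i | i : 'I_q].

Lemma card_used : #|used| = q.
Proof.
by rewrite card_imset ?card_ord // => i j /(bI (ltn_ord i) (ltn_ord j)) /val_inj.
Qed.

Lemma usedP t : reflect (exists2 i, i < q & t = b i) (t \in used).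
Proof.
apply: (iffP imsetP) => [[i _ ->]|[i iq ->]]; first by exists i.
by exists (Ordinal iq).
Qed.

Lemma completion :
    (forall S : {set 'I_n}, S != set0 -> (forall i, i \in S -> q <= i) ->
      #|S| <= #|\bigcup_(i in S) (Warc i :\: used)|) ->
  has_hamiltonian_cycle n.
Proof.
move=> H; have n0 : 0 < n by lia.
have [S SL|f [fN fI]] := @hall _ _ (b 0) (fun i : 'I_n => Warc i :\: used) [set i : 'I_n | q <= i].
  have [->|S0] := eqVneq S set0; first by rewrite cards0.
  by apply: H => // i /(subsetP SL); rewrite inE.
pose a (i : 'I_n) := if i < q then b i else f i.
have fW (i : 'I_n) : q <= i -> f i \in Warc i /\ f i \notin used.
  by move=> qi; have := fN i; rewrite !inE => /(_ qi) /andP[-> ->].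
exists (fun i => c i), a; split=> [i j /cI E|]; last split=> [i j|]; last split=> i.
- by apply: val_inj; apply: E.
- rewrite /a; case: ltnP => iq; case: ltnP => jq.
  + by move=> /(bI iq jq) /val_inj.
  + by move=> E; have [_ /usedP[]] := fW j jq; exists i.
  + by move=> E; have [_ /usedP[]] := fW i iq; exists j.
  + by apply: fI; rewrite inE.
- by rewrite /a; case: ltnP => iq; [exact: bA | have [/WarcA] := fW i iq].
- rewrite /a -[nat_of_ord (ordS i)]/(nx i); case: ltnP => iq.
    rewrite nxE // ; case: eqP => [E|_]; [lia|exact: bP].
  by have [] := fW i iq; rewrite inE => /andP[].
Qed.

Lemma card_unfixed (S : {set 'I_n}) : (forall i, i \in S -> q <= i) -> #|S| <= n - q.
Proof.
move=> Sq; have sub : S \subset ~: [set widen_ord (ltnW qn) j | j : 'I_q].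
  apply/subsetP => j jS; rewrite inE; apply/imsetP => -[j' _ E].
  by have := Sq j jS; rewrite E /= leqNgt ltn_ord.
apply: leq_trans (subset_leq_card sub) _.
rewrite cardsCs setCK card_imset ?card_ord // => j j' /(congr1 val) /= E; exact: val_inj.
Qed.

(** Each free step has at least [n] majority hyperarcs, of which at most [q] are used: enough for
    all [n - q] free steps. *)
Lemma completion_large : n.*2 - 1 <= 'C(n - 2, k - 2) -> has_hamiltonian_cycle n.
Proof.
move=> big; apply: completion => S /set0Pn[i iS] Sq.
apply: leq_trans (card_unfixed Sq) _; apply: leq_trans (subset_leq_card (bigcup_sup i iS)).
have := maj (i := i); rewrite (Sq i iS) ltn_ord => /(_ isT) m.
rewrite cardsD; have := subset_leq_card (subsetIr (Warc i) used); rewrite card_used; lia.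
Qed.

(** The starting vertices of the steps that [t] can serve have distinct positions in [t], never the
    last one. *)
Lemma card_arc_positions (S : {set 'I_n}) t : t \in A -> #|[set i in S | t \in Warc i]| <= k - 1.
Proof.
move=> tA; have ut : uniq t by case: HA => /(_ t tA).
have lt (i : 'I_n) : t \in Warc i -> index (c i) t < k - 1.
  rewrite inE => /andP[_ /and3P[_ yt]] lt; have := yt; rewrite -index_mem size_tuple => lt'.
  apply: leq_trans lt _; rewrite -ltnS subn1 prednK //; lia.
have k1 : 0 < k - 1 by lia.
pose h (i : 'I_n) : 'I_(k - 1) := insubd (Ordinal k1) (index (c i) t).
rewrite -[X in _ <= X]card_ord -(card_in_imset (f := h)); first exact: max_card.
move=> i j; rewrite inE => /andP[_ iW]; rewrite inE => /andP[_ jW] /(congr1 val).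
rewrite !val_insubd !lt // => E.
have ct (l : 'I_n) : t \in Warc l -> c l \in t.
  by move=> /Warc_cedge/subsetP/(_ (c l)); rewrite !inE eqxx => /(_ isT).
apply/val_inj/(cI (ltn_ord i) (ltn_ord j)).
by rewrite -(nth_index (c i) (ct i iW)) E nth_index // ct.
Qed.

(** A used triple can serve a free step only if their two steps are adjacent. So for [q < n.-1] a
    free step loses at most one of its three or more hyperarcs, and double counting applies, as a
    triple serves at most two steps. For [q = n.-1] the only free step loses at most two. *)
Lemma completion_k3 : k = 3 -> has_hamiltonian_cycle n.
Proof.
move=> k_3; have cW i : q <= i < n -> 3 <= #|Warc i|.
  have E : 'C(n - 2, k - 2) = n - 2 by rewrite k_3 bin1.
  by move=> /maj; rewrite E; lia.
have meet i t : q <= i < n -> t \in Warc i -> t \in used -> t = b i.-1 /\ i = q \/ t = b 0 /\ i.+1 = n.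
  move=> /andP[qi il] tW /usedP[j jq E]; have jl : j < n by lia.
  have ij : i != j by lia.
  have : ~~ ((i != nx j) && (j != nx i)).
    apply/negP => /andP[i1 i2]; have := cedge_disjoint il jl ij i1 i2.
    have : cedge i :|: cedge j \subset vset t.
      by rewrite subUset (Warc_cedge tW) E b_cedge.
    by move/subset_leq_card; rewrite (card_vset HA (WarcA tW)) k_3; lia.
  have := nxP il; have := nxP jl => nj ni /nandP[] /negPn/eqP.
    by left; split; [rewrite E; congr b|]; lia.
  by right; split; [rewrite E; congr b|]; lia.
apply: completion => S /set0Pn[i0 i0S] Sq.
have Wq (i : 'I_n) : i \in S -> 3 <= #|Warc i| by move=> iS; apply: cW; rewrite Sq /=.
case: (eqVneq q n.-1) => [qE|qne].
  have S1 : S = [set i0].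
    apply/setP => j; rewrite inE; apply/idP/eqP => [jS|->//]; apply: ord_inj.
    by have := Sq j jS; have := Sq i0 i0S; have := ltn_ord j; have := ltn_ord i0; lia.
  rewrite S1 cards1 big_set1 cardsD.
  have : Warc i0 :&: used \subset [set b i0.-1; b 0].
    apply/subsetP => t /setIP[tW tu]; rewrite !inE.
    by have [|[-> _]|[-> _]] := meet i0 t _ tW tu; rewrite ?eqxx ?orbT // Sq /=.
  move/subset_leq_card; have := Wq i0 i0S; rewrite cards2.
  case: (b i0.-1 != b 0); lia.
apply: (@leq_card_incidence _ _ _ _ (fun (i : 'I_n) (t : k.-tuple V) => t \in Warc i) 2 2) => // [i iS|t tN].
  have : Warc i :\: used \subset [set t in \bigcup_(i in S) (Warc i :\: used) | t \in Warc i].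
    apply/subsetP => t tW; rewrite inE; apply/andP; split; last by case/setDP: tW.
    by apply/bigcupP; exists i.
  move/subset_leq_card; apply: leq_trans; rewrite cardsD.
  have : Warc i :&: used \subset [set if (i : nat) == q then b i.-1 else b 0].
    apply/subsetP => t /setIP[tW tu]; rewrite !inE.
    have [|[-> iq]|[-> iq]] := meet i t _ tW tu; first by rewrite Sq /=.
      by rewrite iq eqxx.
    by case: (eqVneq (i : nat) q) => // iq'; exfalso; lia.
  by move/subset_leq_card; have := Wq i iS; rewrite cards1; lia.
have tA : t \in A by case/bigcupP: tN => i _ /setDP[/WarcA].
by apply: leq_trans (card_arc_positions S tA) _; lia.
Qed.

(** Each free step has five hyperarcs or more. Two free steps share at most four of them, and at
    most one if the steps are disjoint; among three free steps two are disjoint. *)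
Lemma completion_n7 : n = 7 -> k = 4 -> q <= 4 -> has_hamiltonian_cycle n.
Proof.
move=> n_7 k_4 q4; have cW (i : 'I_n) : q <= i -> 5 <= #|Warc i|.
  have E : 'C(n - 2, k - 2) = 10 by rewrite n_7 k_4.
  by move=> qi; have := maj (i := i); rewrite qi ltn_ord E => /(_ isT); lia.
have cWW (i j : 'I_n) : #|Warc i :&: Warc j| <= #|supersets k (cedge i :|: cedge j)|.
  rewrite -card_arcs_on; apply: subset_leq_card; apply/subsetP => t /setIP[ti tj].
  by rewrite inE (WarcA ti) subUset !Warc_cedge.
apply: completion => S S0 Sq.
have cU : \bigcup_(i in S) (Warc i :\: used) = (\bigcup_(i in S) Warc i) :\: used.
  apply/setP => t; rewrite inE; apply/bigcupP/andP => [[i iS /setDP[tW tu]]|[tu /bigcupP[i iS tW]]].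
    by split=> //; apply/bigcupP; exists i.
  by exists i; rewrite // inE tu.
have low m : m <= #|\bigcup_(i in S) Warc i| -> m - q <= #|\bigcup_(i in S) (Warc i :\: used)|.
  rewrite cU cardsD => le.
  by have := subset_leq_card (subsetIr (\bigcup_(i in S) Warc i) used); rewrite card_used; lia.
have two (i j : 'I_n) : i \in S -> j \in S ->
    10 - #|supersets k (cedge i :|: cedge j)| <= #|\bigcup_(i in S) Warc i|.
  move=> iS jS; have : Warc i :|: Warc j \subset \bigcup_(i in S) Warc i.
    by rewrite subUset; apply/andP; split; [exact: (bigcup_sup i iS)|exact: (bigcup_sup j jS)].
  move/subset_leq_card; rewrite cardsU.
  by have := cWW i j; have := cW i (Sq i iS); have := cW j (Sq j jS); lia.
case/set0Pn: S0 => i iS.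
have [Si|[j]] := set_0Vmem (S :\ i).
  have -> : S = [set i].
    apply/setP => j; rewrite inE; apply/idP/eqP => [jS|->//]; apply/eqP.
    by apply: contraT => ji; have : j \in S :\ i by [rewrite !inE ji]; rewrite Si inE.
  rewrite cards1 big_set1 cardsD; have := cW i (Sq i iS).
  by have := subset_leq_card (subsetIr (Warc i) used); rewrite card_used; lia.
rewrite !inE => /andP[ji jS].
have [Sij|[l]] := set_0Vmem (S :\ i :\ j).
  have -> : #|S| = 2.
    by rewrite (cardsD1 i S) iS (cardsD1 j (S :\ i)) !inE ji jS Sij cards0.
  have c3 : 3 <= #|cedge i :|: cedge j|.
    by apply: card_setU_neq; rewrite ?card_cedge // cedge_neq // eq_sym.
  have s4 : #|supersets k (cedge i :|: cedge j)| <= 4.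
    case: (leqP 4 #|cedge i :|: cedge j|) => c4.
      by apply: leq_trans (supersets_le1 _) _; rewrite // k_4.
    by rewrite card_supersets ?k_4; [have -> : #|cedge i :|: cedge j| = 3 by [lia]; rewrite Vn n_7|lia].
  apply: leq_trans (low 6 _); first by lia.
  by apply: leq_trans (two i j iS jS); lia.
rewrite !inE => /and3P[lj li lS].
have [u [w [uS wS uw]]] : exists u w : 'I_n, [/\ u \in S, w \in S & u.+1 < w].
  have ne (u w : 'I_n) : u != w -> (u : nat) != w by [].
  have := ne _ _ ji; have := ne _ _ lj; have := ne _ _ li => h1 h2 h3.
  have [] : (i.+1 < j \/ j.+1 < i) \/ (i.+1 < l \/ l.+1 < i) \/ (j.+1 < l \/ l.+1 < j) by lia.
    by case; [exists i, j|exists j, i].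
  by case; case; [exists i, l|exists l, i|exists j, l|exists l, j].
apply: leq_trans (card_unfixed Sq) _; apply: leq_trans (low 9 _); first by lia.
have uq := Sq u uS.
have c4 : #|cedge u :|: cedge w| = 4.
  by apply: cedge_disjoint; rewrite ?ltn_ord //; have := nxP (ltn_ord u); have := nxP (ltn_ord w); lia.
apply: leq_trans (two u w uS wS).
by have := @supersets_le1 V k (cedge u :|: cedge w); rewrite c4 k_4 => /(_ isT); lia.
Qed.

Lemma card_norev : 1 < q -> #|arcs_from (c q) (c 0)| = 'C(n - 2, k - 2).
Proof.
move=> q1; rewrite -Vn -(@card_arcs_from (c q) (c 0)) ?norev ?cards0 ?addn0 //; last by lia.
by rewrite c_eq //; lia.
Qed.

(** By [card_norev] all ten hyperarcs on the ends of the last step have the right direction, and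
    only six are used. *)
Lemma completion_n7_q6 : n = 7 -> k = 4 -> q = 6 -> has_hamiltonian_cycle n.
Proof.
move=> n_7 k_4 q_6; apply: completion => S /set0Pn[i iS] Sq.
have only j : j \in S -> (j : nat) = 6 by move=> /Sq; have := ltn_ord j; lia.
have -> : S = [set i].
  apply/setP => j; rewrite inE; apply/idP/eqP => [jS|->//]; apply: ord_inj.
  by rewrite !only.
rewrite cards1 big_set1 /Warc (only i iS) cardsD.
have -> : c (nx 6) = c 0 by congr c; have := @nxP 6; lia.
have C : 'C(n - 2, k - 2) = 10 by rewrite n_7 k_4.
have -> : c 6 = c q by rewrite q_6.
have := subset_leq_card (subsetIr (arcs_from (c q) (c 0)) used).
by rewrite card_norev ?card_used ?C; lia.
Qed.

(* With [n = 7] and [k = 4], Hall's condition for the two free steps fails only if all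
   five hyperarcs from [c 5] to [c 6] (or from [c 6] to [c 0]) are used; then [c 6] is
   moved to the other side of [c 5] (or of [c 0]). *)
Lemma completion_n7_q5 : n = 7 -> k = 4 -> q = 5 -> has_hamiltonian_cycle n.
Proof.
move=> n_7 k_4 q_5.
have C : 'C(n - 2, k - 2) = 10 by rewrite n_7 k_4.
pose W5 := arcs_from (c 5) (c 6); pose W6 := arcs_from (c 6) (c 0).
have n6 : nx 6 = 0 by have := @nxP 6; lia.
have n5 : nx 5 = 6 by have := @nxP 5; lia.
have c5 : 5 <= #|W5| by have := maj (i := 5); rewrite /Warc n5 C => /(_ ltac:(lia)); rewrite -/W5; lia.
have c6 : 5 <= #|W6| by have := maj (i := 6); rewrite /Warc n6 C => /(_ ltac:(lia)); rewrite -/W6; lia.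
have cne i j : i < 7 -> j < 7 -> i != j -> c i != c j.
  by move=> il jl; rewrite c_eq //; lia.
have cX : #|arcs_from (c 5) (c 0)| = 10 by rewrite -{1}q_5 card_norev ?C //; lia.
have cu : #|used| = 5 by rewrite card_used q_5.
have bu i : i < 5 -> b i \in used by move=> i5; apply/usedP; exists i; rewrite ?q_5.
(* Of the ten hyperarcs from [c 5] to [c 0], five may be used and one may be [D]. *)
have closing (D : k.-tuple V) : exists E, [/\ E \in A, precedes E (c 5) (c 0), E \notin used & E != D].
  have : 0 < #|arcs_from (c 5) (c 0) :\: (D |: used)|.
    rewrite cardsD; have := subset_leq_card (subsetIr (arcs_from (c 5) (c 0)) (D |: used)).
    by rewrite cX cardsU1 cu; case: (D \notin used); lia.
  case/card_gt0P => E; rewrite inE 2!inE negb_or inE => /andP[/andP[ED Eu] /andP[EA EP]].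
  by exists E; split.
have reroute (s : seq nat) (t : seq (k.-tuple V)) D E :
    perm_eq s (iota 0 7) -> perm_eq t (map b (iota 0 5) ++ [:: D; E]) ->
    D \notin used -> E \notin used -> E != D ->
    (forall t0 i, i < 7 -> nth t0 t i \in A /\
       precedes (nth t0 t i) (c (nth 0 s i)) (c (nth 0 s (i.+1 %% 7)))) ->
  has_hamiltonian_cycle n.
  move=> ps pt Du Eu ED H; have ss : size s = 7 by rewrite (perm_size ps) size_iota.
  apply: (@cycle_of_seqs n (map c s) t); first by lia.
  - by rewrite size_map ss n_7.
  - by rewrite (perm_size pt) size_cat size_map size_iota n_7.
  - have ps7 (i : nat) : i \in s -> i < 7.
      move=> is_; have {is_} : i \in iota 0 7 by rewrite -(perm_mem ps).
      by rewrite mem_iota.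
    rewrite map_inj_in_uniq ?(perm_uniq ps) ?iota_uniq // => i j /ps7 il /ps7 jl.
    by apply: cI; lia.
  - have ub : uniq (map b (iota 0 5)).
      rewrite map_inj_in_uniq ?iota_uniq // => i j; rewrite !mem_iota => il jl.
      by apply: bI; lia.
    have nb z : z \notin used -> z \notin map b (iota 0 5).
      by apply: contra => /mapP[i]; rewrite mem_iota => il ->; apply: bu; lia.
    rewrite (perm_uniq pt) cat_uniq ub; apply/andP; split=> //; apply/andP; split.
      by apply/hasPn => z zDE; apply: nb; move: zDE; rewrite !inE => /orP[] /eqP ->.
    by rewrite /= inE eq_sym ED.
  - move=> x0 t0 i; rewrite n_7 => il; have [tA tP] := H t0 i il; split=> //.
    by rewrite !(nth_map 0) ?ss ?ltn_mod.
have bA' i : i < 5 -> b i \in A by move=> i5; apply: bA; rewrite q_5.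
have bP' i : i < 5 -> precedes (b i) (c i) (c i.+1) by move=> i5; apply: bP; rewrite q_5.
have full (W : {set k.-tuple V}) : W \subset used -> 5 <= #|W| -> #|W| = 5 /\ W = used.
  move=> sub cW; have := subset_leq_card sub; rewrite cu => le.
  by split; [lia | apply/eqP; rewrite eqEcard sub cu].
have fresh x y : x != y -> arcs_from x y = used -> #|arcs_from x y| = 5 ->
    exists D, [/\ D \in A, precedes D y x & D \notin used].
  move=> xy Wu W5c; have := @card_arcs_from x y xy ltac:(lia); rewrite Vn C W5c => cc.
  have : 0 < #|arcs_from y x| by lia.
  case/card_gt0P => D; rewrite inE => /andP[DA DP]; exists D; split=> //.
  rewrite -Wu inE DA /=; have [yD xD _] := precedes_mem DP.
  by rewrite (precedes_total DA xD yD xy) DP.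
case: (boolP (W5 \subset used)) => s5.
  have [W5c W5u] := full _ s5 c5.
  have [D [DA DP Du]] := fresh _ _ (@cne 5 6 isT isT isT) W5u W5c.
  have [E [EA EP Eu ED]] := closing D.
  (* As [b 4] belongs to [W5], it has [c 4], [c 5], [c 6] in this order and can skip [c 5]. *)
  have b4 : precedes (b 4) (c 4) (c 6).
    apply: precedes_trans (bP' 4 isT) _.
    by have := bu 4 isT; rewrite -W5u inE => /andP[].
  apply: (reroute [:: 0; 1; 2; 3; 4; 6; 5] [:: b 0; b 1; b 2; b 3; b 4; D; E] D E) => //.
  move=> t0 [|[|[|[|[|[|[|i]]]]]]] //= _; split=> //; try exact: bA'; exact: bP'.
case: (boolP (W6 \subset used)) => s6.
  have [W6c W6u] := full _ s6 c6.
  have [D [DA DP Du]] := fresh _ _ (@cne 6 0 isT isT isT) W6u W6c.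
  have [E [EA EP Eu ED]] := closing D.
  have b0 : precedes (b 0) (c 6) (c 1).
    apply: precedes_trans (bP' 0 isT).
    by have := bu 0 isT; rewrite -W6u inE => /andP[].
  apply: (reroute [:: 0; 6; 1; 2; 3; 4; 5] [:: D; b 0; b 1; b 2; b 3; b 4; E] D E) => //.
    exact/permPl/(perm_catCA [:: D] [:: b 0; b 1; b 2; b 3; b 4] [:: E]).
  move=> t0 [|[|[|[|[|[|[|i]]]]]]] //= _; split=> //; try exact: bA'; exact: bP'.
have [t5 t5W t5u] := subsetPn s5; have [t6 t6W t6u] := subsetPn s6.
have two : 2 <= #|(W5 :|: W6) :\: used|.
  rewrite leqNgt; apply/negP => le1.
  have i5 : 4 <= #|W5 :&: used|.
    have := cardsD W5 used; have : W5 :\: used \subset (W5 :|: W6) :\: used by rewrite setSD ?subsetUl.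
    by move/subset_leq_card; lia.
  have i6 : 4 <= #|W6 :&: used|.
    have := cardsD W6 used; have : W6 :\: used \subset (W5 :|: W6) :\: used by rewrite setSD ?subsetUr.
    by move/subset_leq_card; lia.
  have := cardsUI (W5 :&: used) (W6 :&: used).
  have := subset_leq_card (_ : (W5 :&: used) :|: (W6 :&: used) \subset used).
  rewrite subUset !subsetIr => /(_ isT); rewrite cu.
  have : (W5 :&: used) :&: (W6 :&: used) \subset [set b 0; b 4].
    apply/subsetP => t /setIP[/setIP[tW5 tu] /setIP[tW6 _]].
    case/usedP: tu => j; rewrite q_5 => j5 E.
    case: (eqVneq j 0) => [j0|j0]; first by rewrite E j0 !inE eqxx.
    case: (eqVneq j 4) => [j4|j4]; first by rewrite E j4 !inE eqxx orbT.
    exfalso; have tA : t \in A by move: tW5; rewrite inE => /andP[].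
    have mem i : i \in [:: 5; 6; 0; j; j.+1] -> c i \in t.
      have [m5 m6 _] := precedes_mem (bP' j j5); rewrite -E in m5 m6.
      move: tW5 tW6; rewrite !inE => /andP[_ /precedes_mem[p1 p2 _]] /andP[_ /precedes_mem[_ p3 _]].
      by do 4?[case/orP]; move=> /eqP ->.
    have : #|[set x in map c [:: 5; 6; 0; j; j.+1]]| <= #|vset t|.
      apply: subset_leq_card; apply/subsetP => x; rewrite inE => /mapP[i im ->].
      by rewrite inE mem.
    have /andP[uj /allP lt7] :
        uniq [:: 5; 6; 0; j; j.+1] && all (fun i => i < 7) [:: 5; 6; 0; j; j.+1].
      by case: j j0 j4 j5 {E mem} => [|[|[|[|[|j]]]]].
    have um : uniq (map c [:: 5; 6; 0; j; j.+1]).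
      by rewrite map_inj_in_uniq // => i1 i2 /lt7 h1 /lt7 h2; apply: cI; rewrite n_7.
    by rewrite (card_vset HA tA) cardsE (card_uniqP um) size_map /= k_4.
  by move/subset_leq_card; rewrite cards2; case: (b 0 != b 4); lia.
have l5 : 5 < n by lia.
have l6 : 6 < n by lia.
pose o5 := Ordinal l5; pose o6 := Ordinal l6.
apply: completion => S /set0Pn[i0 i0S] Sq.
have S56 : S \subset [set o5; o6].
  apply/subsetP => j jS; rewrite !inE; have := Sq j jS; rewrite q_5 => j5.
  by rewrite -!val_eqE /=; have := ltn_ord j; lia.
have N5 : o5 \in S -> W5 :\: used \subset \bigcup_(i in S) (Warc i :\: used).
  by move=> oS; apply: subset_trans (bigcup_sup o5 oS); rewrite /Warc n5.
have N6 : o6 \in S -> W6 :\: used \subset \bigcup_(i in S) (Warc i :\: used).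
  by move=> oS; apply: subset_trans (bigcup_sup o6 oS); rewrite /Warc n6.
case: (boolP ((o5 \in S) && (o6 \in S))) => [/andP[S5 S6]|nS].
  apply: leq_trans (subset_leq_card S56) _; rewrite cards2; apply: leq_trans two _.
  by apply: subset_leq_card; rewrite setDUl subUset N5 ?N6.
have S1 : #|S| <= 1.
  have : S \subset [set if o5 \in S then o5 else o6].
    apply/subsetP => j jS; have := subsetP S56 j jS; rewrite !inE.
    case/orP=> /eqP Ej; first by rewrite -Ej jS.
    by case: ifP => [S5|_]; [rewrite S5 -Ej jS in nS | rewrite Ej].
  by move/subset_leq_card; rewrite cards1.
apply: leq_trans S1 _; apply/card_gt0P.
have := subsetP S56 i0 i0S; rewrite !inE => /orP[] /eqP Ei; rewrite Ei in i0S.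
  by exists t5; apply: (subsetP (N5 i0S)); rewrite inE t5u.
by exists t6; apply: (subsetP (N6 i0S)); rewrite inE t6u.
Qed.

(** The bound [2n - 1 <= 'C(n - 2, 2)] is an equality at [n = 8] and fails at [n = 7], where only
    [k = 4] remains besides [k = 3]. *)
Theorem completion_hamiltonian : has_hamiltonian_cycle n.
Proof.
case: (eqVneq k 3) => [|k_3]; first exact: completion_k3.
case: (eqVneq n 7) => [n_7|n_7]; last first.
  apply: completion_large; have := @leq_card_supersets4 V _ k [set c 0; c 1].
  have c2 : #|[set c 0; c 1]| = 2 by rewrite cards2 c_eq //; lia.
  rewrite Vn card_supersets ?c2 ?Vn; last by lia.
  move=> /(_ ltac:(lia) erefl ltac:(lia) ltac:(lia)); apply: leq_trans.
  by rewrite bin2 -divn2 leq_divRL //; nia.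
have k_4 : k = 4 by lia.
case: (leqP q 4) => q4; first exact: completion_n7.
case: (eqVneq q 5) => [q_5|q_5]; first exact: completion_n7_q5.
by apply: completion_n7_q6 => //; lia.
Qed.

End Completion.
End Majority.

(** * First and last strong components of a tournament *)

Lemma connect_exit (T : finType) (e : rel T) (P : pred T) x y :
  connect e x y -> P x -> ~~ P y ->
  exists z w, [/\ connect e x z, P z, ~~ P w & e z w].
Proof.
move=> /connectP[p]; elim: p x => [|w p IH] x /=; first by move=> _ -> ->.
move=> /andP[exw pp] yE Px nPy; case: (boolP (P w)) => Pw.
  have [z [z' [cz Pz Pz' ez]]] := IH w pp yE Pw nPy.
  by exists z, z'; split=> //; apply: connect_trans cz; apply: connect1.
by exists x, w; split=> //; apply: connect0.
Qed.

Section Extremal.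
Variables (T : finType) (e : rel T).
Hypothesis tour : tournament e.

Definition sources := [pred z | [forall w, connect e z w]].
Definition sinks := [pred z | [forall w, connect e w z]].

Lemma sourcesP z : reflect (forall w, connect e z w) (z \in sources).
Proof. exact: forallP. Qed.
Lemma sinksP z : reflect (forall w, connect e w z) (z \in sinks).
Proof. exact: forallP. Qed.

(** A vertex with the largest reach reaches everything: an unreached [w] would dominate it and have
    a larger reach. *)
Lemma sources_nonempty : 0 < #|T| -> exists z, z \in sources.
Proof.
case/card_gt0P => x0 _; pose f z := #|connect e z|.
pose z := [arg max_(z > x0) f z]; exists z; apply/sourcesP => w.
rewrite /z; case: arg_maxnP => // {}z _ zmax; apply: contraT => zw.
have ewz : e w z.
  apply: (narc tour); first by apply: contraNneq zw => ->; exact: connect0.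
  by apply: contra zw; apply: connect1.
have : f w <= f z := zmax w isT; rewrite leqNgt => /negP[]; apply: proper_card.
rewrite properE; apply/andP; split.
  by apply/subsetP => y zy; apply: connect_trans (connect1 ewz) zy.
by apply/subsetPn; exists w => //; exact: connect0.
Qed.

Lemma sinks_nonempty : 0 < #|T| -> exists z, z \in sinks.
Proof.
case/card_gt0P => x0 _; pose f z := #|[pred w | connect e w z]|.
pose z := [arg max_(z > x0) f z]; exists z; apply/sinksP => w.
rewrite /z; case: arg_maxnP => // {}z _ zmax; apply: contraT => wz.
have ezw : e z w.
  apply: (narc tour); first by apply: contraNneq wz => ->; exact: connect0.
  by apply: contra wz; apply: connect1.
have : f w <= f z := zmax w isT; rewrite leqNgt => /negP[]; apply: proper_card.
rewrite properE; apply/andP; split.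
  by apply/subsetP => y; rewrite !inE => yz; apply: connect_trans yz (connect1 ezw).
by apply/subsetPn; exists w; rewrite !inE ?connect0.
Qed.

Lemma source_arc x w : x \in sources -> w \notin sources -> e x w.
Proof.
move=> /sourcesP xs ws; apply: (narc tour); first by apply: contraNneq ws => ->; apply/sourcesP.
apply: contra ws => ewx; apply/sourcesP => y; exact: connect_trans (connect1 ewx) (xs y).
Qed.

Lemma sink_arc y w : y \in sinks -> w \notin sinks -> e w y.
Proof.
move=> /sinksP ys ws; apply: (narc tour); first by apply: contraNneq ws => <-; apply/sinksP.
apply: contra ws => eyw; apply/sinksP => z; exact: connect_trans (ys z) (connect1 eyw).
Qed.

Lemma strong_or_separated : strong_rel e \/ [disjoint sources & sinks].
Proof.
case: (pickP [pred z | (z \in sources) && (z \in sinks)]) => [z /andP[zs zt]|no]; last first.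
  right; rewrite disjoint_subset; apply/subsetP => z zs; rewrite inE.
  by apply/negP => zt; have := no z; rewrite /= zs zt.
left=> P [x Px] [y nPy]; have cxy : connect e x y.
  exact: connect_trans (sinksP _ zt x) (sourcesP _ zs y).
by have [u [w [_ Pu Pw euw]]] := connect_exit cxy Px nPy; exists u, w.
Qed.

(* A longest path from [x] to [y] avoiding [I] misses no vertex: a missed vertex is a
   source dominating the path or a sink dominated by it, and then some arc contradicts
   its reachability. *)
Section SpanningPath.
Variables (I : {pred T}) (x y : T).
Hypotheses (sep : [disjoint sources & sinks]) (xs : x \in sources) (yt : y \in sinks).
Hypotheses (Is : forall z, z \in I -> z \notin sources) (It : forall z, z \in I -> z \notin sinks).

Lemma extend_path r w : path e x r -> last x r = y -> uniq (x :: r) ->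
    w \notin x :: r -> w \notin I -> {in x :: r, forall z, z \notin I} ->
  exists r', [/\ path e x r', last x r' = y, uniq (x :: r'), size r' = (size r).+1
    & {in x :: r', forall z, z \notin I}].
Proof.
move=> pr lr ur wr wI rI.
pose off := [pred w | (w \notin x :: r) && (w \notin I)].
case: (pickP [pred w | off w && insertable e w (x :: r)]) => [u /andP[/andP[ur' uI] ui]|no].
  have [r' [pr' lr' eq _]] := insert_path tour pr ur' ui.
  have eq' : perm_eq (x :: r') (u :: x :: r).
    rewrite -(perm_cons x) in eq; apply: perm_trans eq _.
    exact/permPl/(perm_catCA [:: x] [:: u]).
  exists r'; split=> //; first by rewrite lr'.
  - by rewrite (perm_uniq eq') cons_uniq ur'.
  - by rewrite (perm_size eq).
  - by move=> z; rewrite (perm_mem eq') inE => /orP[/eqP->|/rI].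
have ynot z : z \in sources -> z \notin sinks by move=> zs; rewrite (disjointFr sep zs).
have yr : y \in x :: r by rewrite -lr mem_last.
have ni u : off u -> ~~ insertable e u (x :: r) by move=> ou; apply: contraFN (no u) => iu; apply/andP.
have dom u z : off u -> u \in sources -> z \in x :: r -> e u z.
  move=> ou us zr; have uy : e u y by apply: sink_arc (ynot u us).
  have unr : u \notin x :: r by case/andP: ou.
  case: (eqVneq z y) => [->//|zy]; apply: (narc tour); first by apply: contraNneq unr => <-.
  apply: contra (ni u ou) => ezu; have := zr; rewrite lastI lr mem_rcons inE (negPf zy) /= => zb.
  case/splitPr: zb => b1 b2; rewrite -cats1 -catA cat_cons.
  by apply: (insertable_cat _ ezu _ uy); rewrite mem_cat mem_seq1 eqxx orbT.
have domby u z : off u -> u \notin sources -> z \in x :: r -> e z u.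
  move=> ou us zr; have xu : e x u by apply: source_arc us.
  have unr : u \notin x :: r by case/andP: ou.
  case: (eqVneq z x) => [->//|zx]; apply: (narc tour); first by apply: contraNneq unr => ->.
  apply: contra (ni u ou) => euz; have := zr; rewrite inE (negPf zx) /= => zb.
  by rewrite /= xu /=; apply/orP; left; apply/hasP; exists z.
exfalso; have ow : off w by rewrite /= wr wI.
(* If a source is missed, some arc enters the set of missed sources. Its tail is a source too, hence
   on the path, where [dom] reverses the arc. *)
case: (pickP [pred a | off a && (a \in sources)]) => [a /andP[oa as_]|nos].
  have cxa : connect e x a by exact: (sourcesP _ xs).
  have Px : ~~ (off x && (x \in sources)) by rewrite /= mem_head.
  have Pa : ~~ ~~ (off a && (a \in sources)) by rewrite negbK; apply/andP.
  have [z [z' [_ nz nz' ezz']]] :=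
    @connect_exit _ e (fun z => ~~ (off z && (z \in sources))) x a cxa Px Pa.
  have /andP[oz' z's] := negPn nz'.
  have zs : z \in sources.
    by apply/sourcesP => t; apply: connect_trans (connect1 ezz') (sourcesP _ z's t).
  have zr : z \in x :: r.
    apply: contraR nz => zr; rewrite zs andbT; apply/andP; split=> //.
    by apply: contraL zs; apply: Is.
  by have := dom z' z oz' z's zr; rewrite (arc_asym tour ezz').
have offs u : off u -> u \notin sources.
  by move=> ou; apply: contraFN (nos u) => us; apply/andP.
have offt u : off u -> u \in sinks.
  move=> ou; apply/sinksP => t; apply: connect_trans (sinksP _ yt t) _.
  by apply: connect1; apply: domby; rewrite ?offs.
(* Now all missed vertices are sinks. The head of an arc leaving them is a sink as well, hence on
   the path, against [domby]. *)
have cwy : connect e w y by exact: (sinksP _ yt).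
have oy : ~~ off y by rewrite /= yr.
have [z [z' [_ oz nz' ezz']]] := @connect_exit _ e off w y cwy ow oy.
have z't : z' \in sinks.
  by apply/sinksP => t; apply: connect_trans (sinksP _ (offt z oz) t) (connect1 ezz').
have z'r : z' \in x :: r.
  apply: contraR nz' => z'r; apply/andP; split=> //.
  by apply: contraL z't; apply: It.
by have := domby z z' oz (offs z oz) z'r; rewrite (arc_asym tour ezz').
Qed.

Lemma spanning_path : x \notin I -> y \notin I ->
  exists r, [/\ path e x r, last x r = y, uniq (x :: r) & forall z, (z \in x :: r) = (z \notin I)].
Proof.
move=> xI yI.
have [N r0] : exists N, exists r, [/\ path e x r, last x r = y, uniq (x :: r)
    & {in x :: r, forall z, z \notin I}] /\ #|T| - size (x :: r) <= N.
  have xy : e x y.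
    by apply: source_arc xs _; apply: contraL yt => ys; rewrite (disjointFr sep ys).
  exists (#|T|), [:: y]; split; last exact: leq_subr.
  split=> //=; first by rewrite xy.
    by rewrite inE (arc_neq tour xy).
  by move=> z; rewrite !inE => /orP[] /eqP ->.
elim: N r0 => [|N IH] [r [[pr lr ur rI] sz]].
  exists r; split=> // z; apply/idP/idP => [/rI//|_].
  apply: contraT => zr; have : size (z :: x :: r) <= #|T|.
    by rewrite -(card_uniqP _) ?max_card // cons_uniq zr.
  by rewrite /= in sz *; lia.
case: (pickP [pred w | (w \notin x :: r) && (w \notin I)]) => [w /andP[wr wI]|no].
  have [r' [pr' lr' ur' sr' rI']] := extend_path pr lr ur wr wI rI.
  by apply: IH; exists r'; split=> //; rewrite /= sr' in sz *; lia.
exists r; split=> // z; apply/idP/idP => [/rI//|zI].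
by have := no z; rewrite /= zI andbT => /negbFE.
Qed.

End SpanningPath.
End Extremal.

(** * The majority tournament and a shortest return path *)

Section Existence.
Variables (V : finType) (n k : nat) (A : {set k.-tuple V}).
Hypotheses (Vn : #|V| = n) (n7 : 7 <= n) (k3 : 3 <= k) (kn : k <= n - 3).
Hypotheses (HA : is_ktournament A) (strA : strong A).

Definition majority : rel V := fun x y => (x != y) &&
  ((#|arcs_from A y x| < #|arcs_from A x y|) ||
   (#|arcs_from A x y| == #|arcs_from A y x|) && (enum_rank x < enum_rank y)).

Lemma majority_tournament : tournament majority.
Proof.
split=> [x|x y xy]; first by rewrite /majority eqxx.
rewrite /majority (eq_sym y x) xy /=.
have : (enum_rank x : nat) != enum_rank y.
  by apply: contraNneq xy => /ord_inj /enum_rank_inj ->.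
case: (ltngtP #|arcs_from A y x| #|arcs_from A x y|) => //= _.
by case: (ltngtP (enum_rank x) (enum_rank y)).
Qed.

Lemma majorityP x y : majority x y -> 'C(n - 2, k - 2) <= 2 * #|arcs_from A x y|.
Proof.
move=> /andP[xy maj]; rewrite -Vn -(card_arcs_from HA xy (ltnW k3)).
by case/orP: maj => [lt|/andP[/eqP E _]]; lia.
Qed.

Definition hyperpath m y x : Prop := exists (v : nat -> V) (b : nat -> k.-tuple V),
  [/\ forall i j, i <= m -> j <= m -> v i = v j -> i = j,
      forall i j, i < m -> j < m -> b i = b j -> i = j,
      forall i, i < m -> b i \in A /\ precedes (b i) (v i) (v i.+1),
      v 0 = y & v m = x].

Lemma strong_hyperpath y x : y != x -> exists m, hyperpath m y x.
Proof.
move=> /strA[m [w [a [[wI [aI [aA aP]]] [w0 wm]]]]]; exists m.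
case: m w a wI aI aA aP w0 wm => [|m] w a wI aI aA aP w0 wm.
  (* For [m = 0] any hyperarc serves as the value of the total function [b]. *)
  have [t0 _] : exists t, t \in A.
    have : 0 < #|[set S : {set V} | #|S| == k]| by rewrite card_draws bin_gt0; lia.
    by case/card_gt0P => S; rewrite inE => /eqP /(arc_exists HA)[t tA _]; exists t.
  exists (fun=> w ord0), (fun=> t0); split=> //; first by move=> i j; lia.
  by rewrite -wm; congr w; apply: ord_inj.
exists (fun i => w (inord i)), (fun i => a (inord i)); split.
- move=> i j im jm /wI /(congr1 val); rewrite /= !inordK //.
- move=> i j im jm /aI /(congr1 val); rewrite /= !inordK //.
- move=> i im; split=> //; have := aP (inord i).
  have -> : widen_ord (leqnSn m.+1) (inord i) = inord i :> 'I_m.+2.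
    by apply: ord_inj; rewrite /= !inordK //; lia.
  have -> // : lift ord0 (inord i : 'I_m.+1) = inord i.+1.
  by apply: ord_inj; rewrite lift0 !inordK //; lia.
- by rewrite -w0; congr w; apply: ord_inj; rewrite inordK.
- by rewrite -wm; congr w; apply: ord_inj; rewrite inordK.
Qed.

(** A path is cut at an inner vertex in [P] or [Q], or replaced by one hyperarc from its start to
    its end, as long as this shortens it. *)
Lemma short_hyperpath (P Q : {pred V}) m y x : [disjoint P & Q] -> y \in P -> x \in Q ->
    hyperpath m y x ->
  exists m' (v : nat -> V) (b : nat -> k.-tuple V),
    [/\ 0 < m', v 0 \in P, v m' \in Q &
      [/\ forall i j, i <= m' -> j <= m' -> v i = v j -> i = j,
          forall i j, i < m' -> j < m' -> b i = b j -> i = j,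
          forall i, i < m' -> b i \in A /\ precedes (b i) (v i) (v i.+1),
          forall i, 0 < i < m' -> (v i \notin P) && (v i \notin Q)
        & 1 < m' -> arcs_from A (v 0) (v m') = set0]].
Proof.
move=> dis; elim/ltn_ind: m y x => m IH y x yP xQ [v [b [vI bI bP v0 vm]]].
have m0 : 0 < m.
  rewrite lt0n; apply/eqP => m0; have := disjointFr dis yP.
  by rewrite -v0 -[in v 0]m0 vm xQ.
case: (boolP (has (fun i => v i \in P) (iota 1 m.-1))) => [/hasP[i]|/hasPn noP].
  rewrite mem_iota => im viP; apply: (IH (m - i) _ (v i) x) => //; first by lia.
  exists (fun j => v (i + j)), (fun j => b (i + j)); split.
  - by move=> j l jm lm /vI; lia.
  - by move=> j l jm lm /bI; lia.
  - by move=> j jm; rewrite addnS; apply: bP; lia.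
  - by rewrite addn0.
  - by rewrite subnKC //; lia.
case: (boolP (has (fun i => v i \in Q) (iota 1 m.-1))) => [/hasP[i]|/hasPn noQ].
  rewrite mem_iota => im viQ; apply: (IH i _ y (v i)) => //; first by lia.
  exists v, b; split=> //.
  - by move=> j l jm lm /vI; lia.
  - by move=> j l jm lm /bI; lia.
  - by move=> j jm; apply: bP; lia.
have inner i : 0 < i < m -> (v i \notin P) && (v i \notin Q).
  by move=> im; rewrite noP ?noQ // mem_iota; lia.
case: (ltnP 1 m) => m1; last first.
  exists m, v, b; split; rewrite ?v0 ?vm //; split=> //.
  by move=> m1'; exfalso; lia.
have [E|[t]] := set_0Vmem (arcs_from A (v 0) (v m)).
  by exists m, v, b; split; rewrite ?v0 ?vm //; split=> //; rewrite -v0 -vm.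
rewrite inE v0 vm => /andP[tA tP].
have yx : y != x by case: (precedes_mem tP).
apply: (IH 1 m1 y x yP xQ).
exists (fun i => if i == 0 then y else x), (fun=> t); split=> //.
- move=> [|[|i]] [|[|j]] //= _ _ E; by rewrite E eqxx in yx.
- by move=> i j; lia.
- by move=> [|i].
Qed.

Lemma cycle_nth (e : rel V) x0 s i : cycle e s -> uniq s -> i < size s ->
  e (nth x0 s i) (nth x0 s (i.+1 %% size s)).
Proof.
case: s => [//|z s] cs us il; have := cs => /= /(pathP x0) /(_ i).
rewrite size_rcons => /(_ il); rewrite -rcons_cons !nth_rcons il /=.
move: il; rewrite /= ltnS leq_eqVlt => /orP[/eqP ->|il].
  by rewrite ltnn eqxx modnn.
by rewrite il modn_small.
Qed.

Theorem hamiltonian_exists : has_hamiltonian_cycle A n.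
Proof.
have tM := majority_tournament; have V0 : 0 < #|V| by lia.
case: (strong_or_separated majority) => [strM|sep].
  have [v0 _] : exists v0 : V, v0 \in V by apply/card_gt0P.
  have [|s [cs us _ ss]] := @strong_vertex_pancyclic _ _ tM strM v0 n.
    by rewrite Vn; lia.
  have arcM i : i < n -> majority (nth v0 s i) (nth v0 s (i.+1 %% n)).
    by move=> il; rewrite -ss; apply: cycle_nth; rewrite ?ss.
  (* The completion starts from at least one given step; here it is a majority hyperarc of the first
     arc, with [q = 1]. *)
  have C0 : 0 < 'C(n - 2, k - 2) by rewrite bin_gt0; lia.
  have [t] : exists t, t \in arcs_from A (nth v0 s 0) (nth v0 s 1).
    apply/card_gt0P; have := majorityP (arcM 0 _); rewrite modn_small; last by lia.
    by move=> /(_ ltac:(lia)); lia.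
  rewrite inE => /andP[tA tP].
  apply: (@completion_hamiltonian _ _ _ HA n 1 (fun i => nth v0 s i) (fun=> t)) => //.
  - by move=> i j il jl /eqP; rewrite nth_uniq ?ss // => /eqP.
  - by lia.
  - by move=> i j; lia.
  - by move=> [|i].
  - by move=> i /andP[_ il]; apply: majorityP; apply: arcM.
have [x0 x0s] := sources_nonempty tM V0; have [y0 y0t] := sinks_nonempty tM V0.
have dis : [disjoint sinks majority & sources majority] by rewrite disjoint_sym.
have yx0 : y0 != x0 by apply: contraTneq y0t => ->; rewrite (disjointFr sep).
have [m0 hp] := strong_hyperpath yx0.
have [q [v [b [q0 vt vs [vI bI bP inner norev]]]]] := short_hyperpath dis y0t x0s hp.
pose I := [pred z | z \in map v (iota 1 q.-1)].
have IP z : z \in I -> exists2 i, 0 < i < q & z = v i.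
  by case/mapP=> i; rewrite mem_iota => ii ->; exists i => //; lia.
have [|||| r [pr lr ur rI]] := @spanning_path _ _ tM I (v q) (v 0) sep vs vt.
- by move=> z /IP[i iq ->]; case/andP: (inner i iq).
- by move=> z /IP[i iq ->]; case/andP: (inner i iq).
- by apply/negP => /IP[i iq E]; have := vI q i (leqnn q) ltac:(lia) E; lia.
- by apply/negP => /IP[i iq E]; have := vI 0 i (leq0n q) ltac:(lia) E; lia.
have r0 : 0 < size r by case: r lr {pr ur rI} => [E|//]; have := vI q 0 (leqnn q) (leq0n q) E; lia.
(* The path [v 0, .., v q] is followed by the spanning path from [v q] back to [v 0], whose repeated
   end [belast] removes. *)
pose w := v 0; pose s := map v (iota 0 q) ++ belast (v q) r.
have us : uniq s.
  have ub : uniq (belast (v q) r) by move: ur; rewrite lastI rcons_uniq => /andP[].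
  rewrite cat_uniq ub andbT map_inj_in_uniq ?iota_uniq /=; last first.
    by move=> i j; rewrite !mem_iota => ii jj; apply: vI; lia.
  apply/hasPn => z zb; apply/mapP => -[i]; rewrite mem_iota => iq E.
  have zr : z \in v q :: r by rewrite lastI mem_rcons inE zb orbT.
  case: (posnP i) => [i0|i0].
    by move: ur; rewrite lastI lr rcons_uniq -i0 -E zb.
  by move: zr; rewrite rI E => /negP[]; apply/map_f; rewrite mem_iota; lia.
have allin z : z \in s.
  rewrite mem_cat; case: (boolP (z \in I)) => [/IP[i iq ->]|].
    by rewrite map_f // mem_iota; lia.
  rewrite -rI lastI lr mem_rcons inE => /orP[/eqP ->|->]; last by rewrite orbT.
  by rewrite map_f // mem_iota; lia.
have ss : size s = n.
  by rewrite -(card_uniqP us) -Vn; apply: eq_card => z; rewrite allin.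
have sq : q + size r = n by rewrite -ss size_cat size_map size_iota size_belast.
have cl i : i <= q -> nth w s i = v i.
  move=> iq; rewrite nth_cat size_map size_iota; case: ltnP => iq'.
    by rewrite (nth_map 0) ?size_iota // nth_iota.
  have -> : i = q by lia.
  by rewrite subnn; case: r r0 {pr lr ur rI s us allin ss sq}.
have cr i : q <= i < n -> nth w s i = nth w (v q :: r) (i - q).
  move=> iq; rewrite nth_cat size_map size_iota ltnNge (proj1 (andP iq)) /=.
  by rewrite lastI nth_rcons size_belast ifT //; lia.
apply: (@completion_hamiltonian _ _ _ HA n q (fun i => nth w s i) b) => //.
- by move=> i j il jl /eqP; rewrite nth_uniq ?ss // => /eqP.
- by lia.
- by move=> i /bP[].
- by move=> i iq; rewrite !cl //; [case: (bP i iq) | lia].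
- move=> i iq; apply: majorityP; rewrite cr //.
  have -> : nth w s (nx n i) = nth w r (i - q).
    rewrite /nx; case: (ltnP i.+1 n) => il.
      by rewrite modn_small // cr ?subSn //; lia.
    have -> : i.+1 = n by lia.
    have sr : size r = (i - q).+1 by lia.
    by rewrite modnn cl // -lr (last_nth w) sr.
  by apply: (pathP w pr); lia.
- by rewrite !cl.
Qed.

End Existence.

Theorem theorem6 (V : finType) (n k : nat) (A : {set k.-tuple V}) :
  #|V| = n -> 7 <= n -> 3 <= k -> k <= n - 3 ->
  is_ktournament A -> strong A ->
  vertex_pancyclic A /\
  (forall (x : 'I_n -> V) (a : 'I_n -> k.-tuple V),
     is_cycle A x a ->
     exists i j l : 'I_n,
       [/\ i != j, i != l, j != l &
         [/\ pancyclic_arc A (a i), pancyclic_arc A (a j) & pancyclic_arc A (a l)]]).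
Proof.
move=> Vn n7 k3 kn HA strA; split.
  have [x [a c]] := hamiltonian_exists Vn n7 k3 kn HA strA.
  by case: (hamiltonian_pancyclic HA Vn n7 k3 kn c).
by move=> x a c; case: (hamiltonian_pancyclic HA Vn n7 k3 kn c).
Qed.
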